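(* Let $(\mathcal V,p,e)$ be a hyperbolic system of degree $n$ and let $\mathbf A=[a_1,a_2,\dots,a_n]$ be a $\mathcal V$-matrix. If $\mathbf A$ is $e$-doubly stochastic, then $$\mathbf A^{T}x\prec\lambda(x)\quad\text{for all } x\in\mathcal V,$$ where $\mathbf A^T x=(\langle a_1,x\rangle,\langle a_2,x\rangle,\dots,\langle a_n,x\rangle)^T\in\mathbb R^n$. The converse holds when $p$ is complete and $\Lambda_+=\Lambda_+^{*}$: in that case, if $\mathbf A^Tx\prec\lambda(x)$ for all $x\in\mathcal V$, then $\mathbf A$ is $e$-doubly stochastic. In particular, the converse holds when the hyperbolic system is $(\mathcal V,\det,e)$ for a Euclidean Jordan algebra $\mathcal V$ of rank $n$ with unit $e$.
   Context: A hyperbolic system $(\mathcal V,p,e)$ of degree $n$ consists of a nonzero finite-dimensional real vector space $\mathcal V$, a nonzero element $e\in\mathcal V$, and a real homogeneous polynomial $p$ of degree $n$ on $\mathcal V$ such that $p(e)\neq 0$ and, for each $x\in\mathcal V$, the univariate polynomial $t\mapsto p(te-x)$ has only real zeros. For $x\in\mathcal V$, $\lambda(x)=(\lambda_1(x),\dots,\lambda_n(x))^T\in\mathbb R^n$ is the vector of these zeros (with multiplicity) in decreasing order. The hyperbolicity cone is $\Lambda_+=\{x\in\mathcal V:\lambda(x)\ge 0\}$. The trace is $\operatorname{tr}(x)=\sum_{i=1}^n\lambda_i(x)$. The polynomial $p$ is complete if $\lambda(x)=0$ implies $x=0$. $\mathcal V$ carries the semi-inner product $\langle x,y\rangle=\frac14\big[\|\lambda(x+y)\|^2-\|\lambda(x-y)\|^2\big]$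 (Euclidean norm on $\mathbb R^n$), which is known to be bilinear and positive semidefinite, and is an inner product when $p$ is complete. The dual cone is $\Lambda_+^*=\{x\in\mathcal V:\langle x,y\rangle\ge 0\ \ \forall y\in\Lambda_+\}$. A $\mathcal V$-matrix is an $n$-tuple $\mathbf A=[a_1,\dots,a_n]$ of elements of $\mathcal V$. It is $e$-doubly stochastic if $a_i\in\Lambda_+$ and $\operatorname{tr}(a_i)=1$ for all $i$, and $a_1+\dots+a_n=e$. For a Euclidean Jordan algebra $(\mathcal V,\circ,\langle\cdot,\cdot\rangle)$ of rank $n$ with unit $e$, $\det(x)$ is the product of the $n$ eigenvalues of $x$ given by the spectral theorem; $(\mathcal V,\det,e)$ is a complete hyperbolic system of degree $n$ whose eigenvalue map is that of the algebra, whose hyperbolicity cone is the cone of squares, and whose inner product above is the trace inner product $\langle x,y\rangle=\operatorname{tr}(x\circ y)$. Majorization in $\mathbb R^n$: $r\prec s$ means $\sum_{i=1}^k r_i^\downarrow\le\sum_{i=1}^k s_i^\downarrow$ for all $1\le k\le n$, with equality for $k=n$, where $r^\downarrow$ is the decreasing rearrangement of $r$. *)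

(* Defs.v *)
From HB Require Import structures.
From mathcomp Require Import all_boot all_order all_algebra.
From mathcomp Require Import mpoly complex polyrcf.
From mathcomp Require Import classical_sets reals.

Set Implicit Arguments.
Unset Strict Implicit.
Unset Printing Implicit Defensive.

Import Order.TTheory GRing.Theory Num.Theory.
Local Open Scope classical_set_scope.
Local Open Scope ring_scope.

(* A polynomial on V is encoded by its expression in the coordinates of the   *)
(* basis [vbasis {:V}]; neither [peval] nor homogeneity depends on the basis. *)
Definition polyOn (R : realType) (V : vectType R) := {mpoly R[\dim {:V}]}.

Definition peval (R : realType) (V : vectType R) (p : polyOn V) (x : V) : R :=
  meval (fun i => coord (vbasis {:V}) i x) p.

Definition line_poly (R : realType) (V : vectType R) (p : polyOn V) (e x : V) :
    {poly R} :=
  mmap (@polyC R)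
    (fun i => (coord (vbasis {:V}) i e)%:P * 'X - (coord (vbasis {:V}) i x)%:P)
    p.

Lemma horner_line_poly (R : realType) (V : vectType R) (p : polyOn V)
    (e x : V) (t : R) :
  (line_poly p e x).[t] = peval p (t *: e - x).
Proof.
rewrite /line_poly /peval /meval /mmap horner_sum; apply: eq_bigr => m _.
rewrite hornerM hornerC /mmap1 horner_prod; congr (_ * _).
apply: eq_bigr => i _.
by rewrite horner_exp !hornerE linearB linearZ /= mulrC.
Qed.

Definition only_real_zeros (R : realType) (P : {poly R}) : Prop :=
  forall z : R[i], root (map_poly (real_complex R) P) z -> z \is Num.real.

(* That V is nonzero follows from [hunit_neq0]. *)
Record hypSystem (R : realType) (V : vectType R) (n : nat) := HypSystem {
  hpoly : polyOn V;
  hunit : V;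
  hunit_neq0 : hunit != 0;
  hpoly_homog : hpoly \is n.-homog;
  hpoly_unit_neq0 : peval hpoly hunit != 0;
  hpoly_real : forall x : V, only_real_zeros (line_poly hpoly hunit x)
}.

(* [rootsR P] lists the distinct real roots of P in increasing order. *)
Definition zeros_decr (R : realType) (P : {poly R}) : seq R :=
  flatten [seq nseq (mup r P) r | r <- rev (rootsR P)].

Definition enorm (R : realType) (n : nat) (v : 'cV[R]_n) : R :=
  Num.sqrt (\sum_(i < n) v i 0 ^+ 2).

(* The list has exactly n items, by [hpoly_real]. *)
Definition lam (R : realType) (V : vectType R) (n : nat) (S : hypSystem V n)
    (x : V) : 'cV[R]_n :=
  \col_(i < n) nth 0 (zeros_decr (line_poly (hpoly S) (hunit S) x)) i.

Definition hcone (R : realType) (V : vectType R) (n : nat)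
    (S : hypSystem V n) : set V :=
  [set x | forall i : 'I_n, 0 <= lam S x i 0].

Definition htr (R : realType) (V : vectType R) (n : nat) (S : hypSystem V n)
    (x : V) : R :=
  \sum_(i < n) lam S x i 0.

Definition hcomplete (R : realType) (V : vectType R) (n : nat)
    (S : hypSystem V n) : Prop :=
  forall x : V, lam S x = 0 -> x = 0.

Definition hip (R : realType) (V : vectType R) (n : nat) (S : hypSystem V n)
    (x y : V) : R :=
  4^-1 * (enorm (lam S (x + y)) ^+ 2 - enorm (lam S (x - y)) ^+ 2).

Definition hdual (R : realType) (V : vectType R) (n : nat)
    (S : hypSystem V n) : set V :=
  [set x | forall y : V, hcone S y -> 0 <= hip S x y].

Definition doubly_stochastic (R : realType) (V : vectType R) (n : nat)
    (S : hypSystem V n) (A : n.-tuple V) : Prop :=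
  [/\ forall i : 'I_n, hcone S (tnth A i),
      forall i : 'I_n, htr S (tnth A i) = 1
    & \sum_(i < n) tnth A i = hunit S].

Definition trmul (R : realType) (V : vectType R) (n : nat) (S : hypSystem V n)
    (A : n.-tuple V) (x : V) : 'cV[R]_n :=
  \col_(i < n) hip S (tnth A i) x.

Definition rearr_decr (R : realType) (n : nat) (r : 'cV[R]_n) : 'cV[R]_n :=
  \col_(i < n) nth 0 (sort >=%R [seq r j 0 | j <- enum 'I_n]) i.

Definition majorized (R : realType) (n : nat) (r s : 'cV[R]_n) : Prop :=
  (forall k : nat, (1 <= k <= n)%N ->
     \sum_(i < n | (i < k)%N) rearr_decr r i 0
       <= \sum_(i < n | (i < k)%N) rearr_decr s i 0) /\
  \sum_(i < n) rearr_decr r i 0 = \sum_(i < n) rearr_decr s i 0.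

(* Linearity of [jmul] and [jip] in the other argument follows by symmetry. *)
Record euclJordan (R : realType) (V : vectType R) := EuclJordan {
  jmul : V -> V -> V;
  jip : V -> V -> R;
  junit : V;
  jmul_linear : forall (x : V) (a : R) (y z : V),
    jmul x (a *: y + z) = a *: jmul x y + jmul x z;
  jmulC : forall x y : V, jmul x y = jmul y x;
  jmul_jordan : forall x y : V,
    jmul x (jmul (jmul x x) y) = jmul (jmul x x) (jmul x y);
  jmul_unit : forall x : V, jmul junit x = x;
  jip_linear : forall (x : V) (a : R) (y z : V),
    jip x (a *: y + z) = a * jip x y + jip x z;
  jipC : forall x y : V, jip x y = jip y x;
  jip_gt0 : forall x : V, x != 0 -> 0 < jip x x;
  jip_assoc : forall x y z : V, jip (jmul x y) z = jip y (jmul x z)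
}.

Definition jpow (R : realType) (V : vectType R) (J : euclJordan V) (x : V)
    (k : nat) : V :=
  iter k (jmul J x) (junit J).

(* m is the degree of the minimal polynomial of x, i.e. the least m such that *)
(* e, x, ..., x^m are linearly dependent.                                     *)
Definition jdegree (R : realType) (V : vectType R) (J : euclJordan V) (x : V)
    (m : nat) : Prop :=
  free (mkseq (jpow J x) m) /\ ~~ free (mkseq (jpow J x) m.+1).

Definition jrank (R : realType) (V : vectType R) (J : euclJordan V)
    (n : nat) : Prop :=
  (exists x : V, jdegree J x n) /\
  (forall (x : V) (m : nat), jdegree J x m -> (m <= n)%N).

Definition jidempotent (R : realType) (V : vectType R) (J : euclJordan V)
    (c : V) : Prop :=
  jmul J c c = c.

Definition jprimitive (R : realType) (V : vectType R) (J : euclJordan V)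
    (c : V) : Prop :=
  [/\ jidempotent J c, c != 0
    & ~ exists a b : V, [/\ jidempotent J a, jidempotent J b,
                            a != 0, b != 0 & c = a + b]].

Definition jordan_frame (R : realType) (V : vectType R) (J : euclJordan V)
    (n : nat) (c : n.-tuple V) : Prop :=
  [/\ forall i : 'I_n, jprimitive J (tnth c i),
      forall i j : 'I_n, i != j -> jmul J (tnth c i) (tnth c j) = 0
    & \sum_(i < n) tnth c i = junit J].

(* In rank n, the spectral theorem says that every x has such an l, unique up *)
(* to order: these are the eigenvalues of x.                                  *)
Definition jeigenvalues (R : realType) (V : vectType R) (J : euclJordan V)
    (n : nat) (x : V) (l : 'cV[R]_n) : Prop :=
  exists c : n.-tuple V,
    jordan_frame J c /\ x = \sum_(i < n) l i 0 *: tnth c i.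

Definition is_jdet (R : realType) (V : vectType R) (J : euclJordan V)
    (n : nat) (f : V -> R) : Prop :=
  forall (x : V) (l : 'cV[R]_n),
    jeigenvalues J x l -> f x = \prod_(i < n) l i 0.

(* Main.v *)
(* For a in the hyperbolicity cone, p(t e + s a - x) does not vanish when Im t    *)
(* and Im s are nonnegative and Im t > 0: deform x to 0 and follow the roots s,   *)
(* which cannot cross the real axis.  Hence D_a p(t e - x) / p(t e - x) maps the  *)
(* upper half-plane to the closed lower one, so it equals \sum_r rho_r / (t - r)  *)
(* over the distinct eigenvalues r of x, with rho_r >= 0.  Expanding at infinity  *)
(* gives \sum_r rho_r = tr a and \sum_r rho_r r = <a, x>.  If e - a is a sum of   *)
(* elements of the cone as well, then rho_r is at most the multiplicity of r.     *)
(* Applied to a sum of k of the a_i this bounds \sum <a_i, x> by the sum of the k *)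
(* largest eigenvalues of x.                                                      *)
(*                                                                                *)
(* Conversely, majorization bounds each <a_i, x> below by the smallest eigenvalue *)
(* of x: with x in the cone this puts a_i in the dual cone, x = e gives tr a_i =  *)
(* 1, and equality of the total sums gives <\sum a_i - e, x> = 0 for all x.       *)
(*                                                                                *)
(* For a Euclidean Jordan algebra only completeness and the inclusion of the dual *)
(* cone in the cone are needed.  On a Jordan frame c_1, ..., c_n both are read    *)
(* off from <\sum l_i c_i, c_k> = l_k; arbitrary elements are limits of regular   *)
(* ones.                                                                          *)

Require Import Defs.
From HB Require Import structures.
From mathcomp Require Import all_boot all_order all_algebra.
From mathcomp Require Import mpoly complex polyrcf.
From mathcomp Require Import boolp classical_sets reals.
From mathcomp Require Import ring lra.

Set Implicit Arguments.
Unset Strict Implicit.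
Unset Printing Implicit Defensive.

Import Order.TTheory GRing.Theory Num.Theory.
Local Open Scope ring_scope.

Import Normc.

(** The statement about hyperbolic polynomials becomes one about partial fractions. By [hipE], trace
    and semi-inner product are first and second derivatives of [p] at [e], hence linear and
    bilinear. When [a] has positive eigenvalues and [Im t > 0], the roots [s] of [p(t e - x + s a)]
    lie strictly below the real axis ([stable]), so the logarithmic derivative of [p(t e - x)] in
    direction [a] maps the upper half-plane to the closed lower one; [lower_dir_hcone] extends this
    to the whole cone. Such a quotient has simple real poles with nonnegative residues
    ([lower_map_simple_pole]). The residues have total mass [tr a] and first moment [<a, x>]
    ([partial_fractions_sums]), and those of [b] and [e - b] add up to the multiplicities
    ([residue_measure]). For [b] a sum of [k] of the [a_i], [<b, x>] is thus a weighted sum of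
    eigenvalues, with weights at most the multiplicities and total [k]: at most the sum of the [k]
    largest ([hip_le_top]).

    The converse rests on [majorized_ge]: a majorized vector stays above the minimum of the
    majorizing one. In the Jordan case, [regular_frame] is the spectral theorem for regular elements
    and [free_jpow_generic] their density; [jordan_complete] and [jordan_dual] follow by letting a
    perturbation tend to 0. *)

(** * Factorization of real-rooted polynomials and their sorted zeros *)

Section RealRooted.
Variable R : realType.
Implicit Types (P : {poly R}) (s : seq R).

(** Factor over the complex numbers; all roots are real, so the factorization descends through the
    injective [map_poly]. *)
Lemma real_rooted_factor P : only_real_zeros P ->
  exists s, P = lead_coef P *: \prod_(z <- s) ('X - z%:P).
Proof.
move=> rP; have [->|nzP] := eqVneq P 0; first by exists [::]; rewrite lead_coef0 scale0r.
have [rs Ers] := closed_field_poly_normal (map_poly (real_complex R) P).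
exists (map (@complex.Re R) rs).
have nzlP : lead_coef P != 0 by rewrite lead_coef_eq0.
have nzlc : lead_coef (map_poly (real_complex R) P) != 0.
  by rewrite lead_coef_eq0 map_poly_eq0.
have rrs : {in rs, forall z, (complex.Re z)%:C%C = z}.
  move=> z zrs; apply: RRe_real; apply: rP.
  by rewrite Ers rootZ // root_prod_XsubC.
apply: (map_inj_poly (@complexI R)); first by rewrite rmorph0.
rewrite /= Ers map_polyZ /= lead_coef_map; congr (_ *: _).
rewrite rmorph_prod big_map big_seq_cond [RHS]big_seq_cond.
apply: eq_bigr => z /andP[zrs _].
by rewrite rmorphB /= map_polyX map_polyC /= rrs.
Qed.

Lemma size_scale_prod_XsubC (c : R) s : c != 0 ->
  size (c *: \prod_(z <- s) ('X - z%:P)) = (size s).+1.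
Proof. by move=> nzc; rewrite size_scale // size_prod_XsubC. Qed.

Lemma count_flatten_nseq (T : eqType) (f : T -> nat) (s : seq T) (r : T) :
  uniq s ->
  count_mem r (flatten [seq nseq (f x) x | x <- s]) = if r \in s then f r else 0%N.
Proof.
elim: s => //= x s IH /andP[xs us].
rewrite count_cat count_nseq /= IH // inE.
have [->|nrx] := eqVneq r x; first by rewrite (negbTE xs) mul1n addn0.
by [].
Qed.

Lemma zeros_decr_perm (c : R) s : c != 0 ->
  perm_eq (zeros_decr (c *: \prod_(z <- s) ('X - z%:P))) s.
Proof.
move=> nzc; set P := _ *: _.
have nzP : P != 0.
  by rewrite scaler_eq0 (negbTE nzc) monic_neq0 // monic_prod_XsubC.
apply/allP => r _ /=; rewrite /zeros_decr count_flatten_nseq ?rev_uniq ?uniq_roots //.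
rewrite mem_rev.
have -> : mup r P = count_mem r s.
  rewrite -mu_prod_XsubC /P -mul_polyC mupMr //.
  by rewrite /root hornerC.
case: ifP => // /negbT nr; rewrite eq_sym; apply/eqP/count_memPn.
apply: contra nr => rs; have := roots_on_rootsR nzP => /(_ r).
rewrite in_itv /= => <-.
by rewrite rootZ // root_prod_XsubC.
Qed.

Lemma sorted_flatten_nseq (f : R -> nat) s :
  sorted >%R s -> sorted >=%R (flatten [seq nseq (f x) x | x <- s]).
Proof.
have trg : transitive (>%R : rel R) by move=> x y z /= yx xz; apply: lt_trans xz yx.
rewrite (sorted_pairwise trg) (sorted_pairwise (rev_trans le_trans)).
elim: s => //= x s IH /andP[ax ps].
rewrite pairwise_cat IH // andbT; apply/andP; split; last first.
  by elim: (f x) => //= m ->; rewrite andbT; apply/allP => y /nseqP[->] /=.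
apply/allrelP => a b /nseqP[-> _] /flattenP[t /mapP[y ys ->]] /nseqP[-> _] /=.
exact/ltW/(allP ax).
Qed.

Lemma sorted_zeros_decr P : sorted >=%R (zeros_decr P).
Proof.
apply: sorted_flatten_nseq; rewrite rev_sorted.
exact: sorted_roots.
Qed.

End RealRooted.

(** * Substitution into multivariate polynomials: homogeneity and chain rule *)

Section Mmap.
Variables (R : comNzRingType) (d n : nat).
Implicit Types (p : {mpoly R[d]}).

Lemma eq_mmap (S : comNzRingType) (f g : R -> S) (h k : 'I_d -> S) p :
  f =1 g -> h =1 k -> mmap f h p = mmap g k p.
Proof.
move=> fg hk; apply: eq_bigr => m _; rewrite fg; congr (_ * _).
by apply: eq_bigr => i _; rewrite hk.
Qed.

Lemma rmorph_mmap (S T : comNzRingType) (g : {rmorphism S -> T})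
    (f : R -> S) (h : 'I_d -> S) p :
  g (mmap f h p) = mmap (g \o f) (g \o h) p.
Proof.
rewrite rmorph_sum; apply: eq_bigr => m _; rewrite rmorphM rmorph_prod.
by congr (_ * _); apply: eq_bigr => i _; rewrite rmorphXn.
Qed.

Lemma mmap_homog_scale (S : comNzRingType) (f : {rmorphism R -> S})
    (h : 'I_d -> S) (c : S) p :
  p \is n.-homog -> mmap f (fun i => c * h i) p = c ^+ n * mmap f h p.
Proof.
move=> /dhomogP ph; rewrite mulr_sumr; apply: eq_big_seq => m /ph <-.
rewrite mulrCA; congr (_ * _).
rewrite /mmap1 (eq_bigr (fun i => c ^+ m i * h i ^+ m i)); last first.
  by move=> i _; rewrite exprMn.
by rewrite big_split /= -expr_sum mdegE.
Qed.

Lemma homog_mderiv i p : p \is n.-homog -> p^`M(i) \is n.-1.-homog.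
Proof.
move=> /dhomogP ph; apply/dhomogP => m; rewrite mcoeff_msupp mcoeff_mderiv => nz.
have /ph /= : (m + U_(i))%MM \in msupp p.
  by rewrite mcoeff_msupp; apply: contraNneq nz => ->; rewrite mul0rn.
by rewrite mdegD mdeg1 addn1 => <-.
Qed.

(** The chain rule: the identity passes to sums and products, so constants and variables suffice. *)
Lemma deriv_mmap (S : comNzRingType) (f : {rmorphism R -> S})
    (h : 'I_d -> {poly S}) p :
  (mmap (polyC \o f) h p)^`() =
  \sum_i (h i)^`() * mmap (polyC \o f) h p^`M(i).
Proof.
pose D q := (mmap (polyC \o f) h q)^`() =
  \sum_i (h i)^`() * mmap (polyC \o f) h q^`M(i).
have D0 c : D c%:MP.
  rewrite /D mmapC /= derivC big1 // => i _; by rewrite mderivC mmap0 mulr0.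
have DD q1 q2 : D q1 -> D q2 -> D (q1 + q2).
  move=> D1 D2; rewrite /D mmapD derivD D1 D2 -big_split /=.
  by apply: eq_bigr => i _; rewrite mderivD mmapD mulrDr.
have DM q1 q2 : D q1 -> D q2 -> D (q1 * q2).
  move=> D1 D2; rewrite /D rmorphM derivM D1 D2 mulr_suml mulr_sumr -big_split /=.
  apply: eq_bigr => i _; rewrite mderivM mmapD !rmorphM /=; ring.
have DX i : D 'X_i.
  rewrite /D mmapX mmap1U (bigD1 i) //= big1 => [|j ji].
    by rewrite mderivX mnmE eqxx scale1r -[X in 'X_[X - _]]add0m addmK
         mpolyX0 rmorph1 mulr1 addr0.
  by rewrite mderivX mnmE eq_sym (negbTE ji) scale0r mmap0 mulr0.
suff : D p by [].
elim/mpolyind: p => [|c m p _ _ IH]; first by rewrite -(mpolyC0 d R); apply: D0.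
apply: DD => //; rewrite -mul_mpolyC; apply: (DM _ _) => //; rewrite mpolyXE_id.
apply: (big_ind D); [by rewrite -mpolyC1; apply: D0|exact: DM|move=> i _].
by elim: (m i) => [|k IHk]; rewrite ?expr0 -?mpolyC1 ?exprS //; apply: (DM _ _).
Qed.

(** The top coefficient takes [v i * 'X] from every factor. The relation [D k q c] (degree at most
    [k], coefficient [c] at [k]) is multiplicative, which reduces the claim to single variables. *)
Lemma size_coef_mmap_affine (S : comNzRingType) (f : {rmorphism R -> S})
    (u v : 'I_d -> S) p : p \is n.-homog ->
  let q := mmap (polyC \o f) (fun i => (u i)%:P + (v i)%:P * 'X) p in
  (size q <= n.+1)%N /\ q`_n = mmap f v p.
Proof.
move=> /dhomogP ph.
pose D k (q : {poly S}) (c : S) := (size q <= k.+1)%N /\ q`_k = c.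
have DM k1 k2 q1 q2 c1 c2 : D k1 q1 c1 -> D k2 q2 c2 ->
    D (k1 + k2)%N (q1 * q2) (c1 * c2).
  move=> [s1 <-] [s2 <-]; split.
    apply: leq_trans (size_polyMleq _ _) _; rewrite -subn1 leq_subLR.
    by rewrite add1n -addnS -addSn leq_add.
  have k1lt : (k1 < (k1 + k2).+1)%N by rewrite ltnS leq_addr.
  rewrite coefM (bigD1 (Ordinal k1lt)) //= addKn big1 ?addr0 // => -[j /= jlt] jk1.
  have {}jk1 : j != k1 by [].
  case: (ltngtP j k1) jk1 => // jk1 _.
    rewrite [q2`__]nth_default ?mulr0 //; apply: leq_trans s2 _.
    by rewrite ltn_subRL ltn_add2r.
  by rewrite [q1`__]nth_default ?mul0r //; apply: leq_trans s1 _.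
have D1 : D 0%N 1 1 by rewrite /D size_poly1 coef1.
have DX w : D 1%N ((u w)%:P + (v w)%:P * 'X) (v w).
  split; last by rewrite coefD coefCM coefC coefX mulr1 add0r.
  apply: leq_trans (size_polyD _ _) _; rewrite geq_max; apply/andP; split.
    by apply: leq_trans (size_polyC_leq1 _) _.
  by rewrite mul_polyC; apply: leq_trans (size_scale_leq _ _) _; rewrite size_polyX.
have DXk w k : D k (((u w)%:P + (v w)%:P * 'X) ^+ k) (v w ^+ k).
  by elim: k => [|k IH]; rewrite ?expr0 ?exprS // -add1n; apply: (DM 1%N).
rewrite /= /mmap; suff : D n (\sum_(m <- msupp p) (polyC \o f) p@_m *
    mmap1 (fun i => (u i)%:P + (v i)%:P * 'X) m)
    (\sum_(m <- msupp p) f p@_m * mmap1 v m) by [].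
rewrite big_seq [X in D _ _ X]big_seq.
apply: (big_ind2 (D n)); first by rewrite /D size_poly0 coef0.
  move=> q1 c1 q2 c2 [s1 <-] [s2 <-]; split; last by rewrite coefD.
  by apply: leq_trans (size_polyD _ _) _; rewrite geq_max s1.
move=> m /ph Em; have <- : mdeg m = n by exact: Em.
rewrite -[mdeg m]add0n; apply: (DM 0%N).
  by rewrite /D /= coefC size_polyC_leq1.
rewrite mdegE /mmap1; elim/big_rec3: _ => // i c1 k1 q1 _ IH; apply: (DM (m i)) => //; exact: DXk.
Qed.

End Mmap.

(** * Eigenvalues, trace and semi-inner product as derivatives of [p] at [e] *)

Section Hyperbolic.
Variables (R : realType) (V : vectType R) (n : nat) (S : hypSystem V n).
Local Notation p := (hpoly S).
Local Notation e := (hunit S).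
Local Notation crd x := (fun i => coord (vbasis {:V}) i x).
Implicit Types (x y a b : V) (q : polyOn V).

(** List form of [lam], in which eigenvalue multisets are compared by [perm_eq]. *)
Definition eig x : seq R := zeros_decr (line_poly p e x).

Lemma size_coef_line_poly q m x : q \is m.-homog ->
  (size (line_poly q e x) <= m.+1)%N /\ (line_poly q e x)`_m = peval q e.
Proof.
move=> qh.
have [] := @size_coef_mmap_affine _ _ m _ idfun (crd (- x)) (crd e) _ qh.
rewrite (@eq_mmap _ _ _ _ (@polyC R) _
  (fun i => (coord (vbasis {:V}) i e)%:P * 'X - (coord (vbasis {:V}) i x)%:P)) //.
by move=> i /=; rewrite linearN /= polyCN addrC.
Qed.

Lemma size_line_poly x : size (line_poly p e x) = n.+1.
Proof.
have [sz cf] := size_coef_line_poly x (hpoly_homog S).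
apply/eqP; rewrite eqn_leq sz /= ltnNge; apply/negP => sz'.
by have := hpoly_unit_neq0 S; rewrite -cf nth_default // eqxx.
Qed.

Lemma line_poly_factor x : exists2 s, size s = n &
  line_poly p e x = peval p e *: \prod_(z <- s) ('X - z%:P).
Proof.
have [s Es] := real_rooted_factor (@hpoly_real _ _ _ S x).
have lc : lead_coef (line_poly p e x) = peval p e.
  rewrite lead_coefE size_line_poly /=.
  by have [_ ->] := size_coef_line_poly x (hpoly_homog S).
exists s; last by rewrite -lc.
have := size_line_poly x; rewrite Es lc size_scale_prod_XsubC ?hpoly_unit_neq0 //.
by case.
Qed.

Lemma perm_eig x s (c : R) : c != 0 ->
  line_poly p e x = c *: \prod_(z <- s) ('X - z%:P) -> perm_eq (eig x) s.
Proof. by move=> nzc E; rewrite /eig E zeros_decr_perm. Qed.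

Lemma line_polyE x :
  line_poly p e x = peval p e *: \prod_(z <- eig x) ('X - z%:P).
Proof.
have [s _ Es] := line_poly_factor x; rewrite [LHS]Es; congr (_ *: _).
by apply: perm_big; rewrite perm_sym (perm_eig _ Es) ?hpoly_unit_neq0.
Qed.

Lemma size_eig x : size (eig x) = n.
Proof.
have [s sz Es] := line_poly_factor x; rewrite -[RHS]sz.
by apply: perm_size; rewrite (perm_eig _ Es) ?hpoly_unit_neq0.
Qed.

Lemma sum_lam x (F : R -> R) : \sum_(i < n) F (lam S x i 0) = \sum_(z <- eig x) F z.
Proof.
rewrite (big_nth 0) size_eig big_mkord; apply: eq_bigr => i _.
by rewrite /lam mxE.
Qed.

Lemma all_lam x (Q : pred R) : (forall i, Q (lam S x i 0)) <-> all Q (eig x).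
Proof.
split=> [h|/(all_nthP 0) h i].
  by apply/(all_nthP 0) => i; rewrite size_eig => lti; have := h (Ordinal lti); rewrite mxE.
by rewrite mxE; apply: h; rewrite size_eig.
Qed.

Lemma htr_eig x : htr S x = \sum_(z <- eig x) z.
Proof. exact: (sum_lam x id). Qed.

Lemma enorm_lam x : enorm (lam S x) ^+ 2 = \sum_(z <- eig x) z ^+ 2.
Proof.
rewrite /enorm sqr_sqrtr; first exact: (sum_lam x (fun z => z ^+ 2)).
by apply: sumr_ge0 => i _; apply: sqr_ge0.
Qed.

Lemma peval_scale q m (c : R) x : q \is m.-homog -> peval q (c *: x) = c ^+ m * peval q x.
Proof.
move=> qh; rewrite /peval /meval -(mmap_homog_scale idfun _ _ qh).
by apply: eq_mmap => // i /=; rewrite linearZ.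
Qed.

(* Setting [t = 1/s] in [p(t e - x)] and clearing denominators. *)
Lemma peval_unit_sub (s : R) x :
  peval p (e - s *: x) = peval p e * \prod_(z <- eig x) (1 - s * z).
Proof.
have [->|nz] := eqVneq s 0.
  rewrite scale0r subr0 big1 ?mulr1 // => z _; by rewrite mul0r subr0.
have -> : e - s *: x = s *: (s^-1 *: e - x).
  by rewrite scalerBr scalerA divff // scale1r.
rewrite (peval_scale _ _ (hpoly_homog S)) -horner_line_poly line_polyE hornerZ.
rewrite mulrCA; congr (_ * _); rewrite horner_prod.
rewrite -[X in s ^+ X](size_eig x) -[X in s ^+ X]count_predT -iter_mulr_1.
rewrite -(big_const_seq 1 *%R) -big_split /=.
by apply: eq_bigr => z _; rewrite !hornerE mulrBr divff.
Qed.

(** The polynomial [s |-> q(b - s x)]. For [b = e] it reverses [line_poly]: behaviour at infinity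
    becomes low-order coefficients, which are Taylor coefficients of [q] at [b]. *)
Definition pencil q b x : {poly R} :=
  mmap (@polyC R) (fun i => (coord (vbasis {:V}) i b)%:P
    - (coord (vbasis {:V}) i x)%:P * 'X) q.

Lemma horner_pencil q b x s : (pencil q b x).[s] = peval q (b - s *: x).
Proof.
rewrite /pencil -[LHS]/(horner_eval s _) rmorph_mmap; apply: eq_mmap => i /=.
  by rewrite /horner_eval hornerC.
by rewrite /horner_eval !hornerE linearB linearZ /= mulrC.
Qed.

Lemma coef0_pencil q b x : (pencil q b x)`_0 = peval q b.
Proof. by rewrite -horner_coef0 horner_pencil scale0r subr0. Qed.

Lemma deriv_pencil q b x : (pencil q b x)^`() =
  - \sum_k coord (vbasis {:V}) k x *: pencil q^`M(k) b x.
Proof.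
rewrite (deriv_mmap idfun) -sumrN; apply: eq_bigr => k _.
by rewrite derivB derivM !derivC derivX mul0r mulr1 !add0r mulNr mul_polyC.
Qed.

Lemma coef1_pencil q b x : (pencil q b x)`_1 =
  - \sum_k coord (vbasis {:V}) k x * peval q^`M(k) b.
Proof.
have -> : (pencil q b x)`_1 = (pencil q b x)^`()`_0 by rewrite coef_deriv.
rewrite deriv_pencil coefN coef_sum; congr (- _); apply: eq_bigr => k _.
by rewrite coefZ coef0_pencil.
Qed.

(** The Hessian of [p] at [e] applied to [x] and [y]. *)
Definition bil x y : R := \sum_k coord (vbasis {:V}) k x *
  \sum_l coord (vbasis {:V}) l y * peval p^`M(k)^`M(l) e.

Lemma coef2_pencil x : 2 * (pencil p e x)`_2 = bil x x.
Proof.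
have -> : 2 * (pencil p e x)`_2 = (pencil p e x)^`()`_1.
  by rewrite coef_deriv mulr_natl.
rewrite deriv_pencil coefN coef_sum -sumrN; apply: eq_bigr => k _.
by rewrite coefZ coef1_pencil mulrN opprK.
Qed.

(** The elementary symmetric functions of order 1 and 2, the latter through Newton's identity. *)
Lemma coef_prod_1subZX (s : seq R) (P := \prod_(z <- s) (1 - z *: 'X)) :
  [/\ P`_0 = 1, P`_1 = - \sum_(z <- s) z &
      2 * P`_2 = (\sum_(z <- s) z) ^+ 2 - \sum_(z <- s) z ^+ 2].
Proof.
rewrite /P {P}; elim: s => [|z s [IH0 IH1 IH2]].
  by rewrite !big_nil !coef1 /=; split=> //; ring.
rewrite !big_cons mulrBl mul1r -scalerAl !coefB !coefZ !coefXM /= IH0 IH1.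
split; [ring | ring |].
rewrite mulrBr IH2; ring.
Qed.

(** Otherwise the difference would vanish at 1, 2, 3, ..., more points than its degree allows. *)
Lemma eq_poly_horner_neq0 (P Q : {poly R}) :
  (forall s, s != 0 -> P.[s] = Q.[s]) -> P = Q.
Proof.
move=> PQ; apply/eqP; rewrite -subr_eq0; apply/negPn/negP => nz.
pose rs : seq R := [seq i.+1%:R | i <- iota 0 (size (P - Q))].
suff : (size rs < size (P - Q)%R)%N by rewrite size_map size_iota ltnn.
apply: max_poly_roots nz _ _.
  apply/allP => _ /mapP[i _ ->]; rewrite /root hornerD hornerN subr_eq0 PQ //.
  by rewrite pnatr_eq0.
rewrite map_inj_uniq ?iota_uniq // => i j /eqP.
by rewrite eqr_nat => /eqP[].
Qed.

Lemma pencilE x :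
  pencil p e x = peval p e *: \prod_(z <- eig x) (1 - z *: 'X).
Proof.
apply: eq_poly_horner_neq0 => s _.
rewrite horner_pencil peval_unit_sub hornerZ horner_prod.
by congr (_ * _); apply: eq_bigr => z _; rewrite !hornerE mulrC.
Qed.

Lemma htrE x : peval p e * htr S x = \sum_k coord (vbasis {:V}) k x * peval p^`M(k) e.
Proof.
have := coef1_pencil p e x; have [_ E1 _] := coef_prod_1subZX (eig x).
by rewrite pencilE coefZ E1 -htr_eig mulrN => /oppr_inj.
Qed.

Let linear_cancel (k c h h1 h2 r r1 r2 : R) : k != 0 ->
  k * h = r -> k * h1 = r1 -> k * h2 = r2 -> r = c * r1 + r2 -> h = c * h1 + h2.
Proof.
move=> k0 E E1 E2 Er; apply: (mulfI k0); rewrite E Er -E1 -E2; ring.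
Qed.

Lemma htr_is_linear (c : R) x y : htr S (c *: x + y) = c * htr S x + htr S y.
Proof.
apply: linear_cancel (hpoly_unit_neq0 S) (htrE _) (htrE _) (htrE _) _.
rewrite mulr_sumr -big_split.
by apply: eq_bigr => k _; rewrite linearP /= mulrDl mulrA.
Qed.

Lemma bil_linearl (c : R) x y z : bil (c *: x + y) z = c * bil x z + bil y z.
Proof.
rewrite /bil mulr_sumr -big_split; apply: eq_bigr => k _.
by rewrite linearP /= mulrDl mulrA.
Qed.

Lemma bilC x y : bil x y = bil y x.
Proof.
rewrite /bil; under eq_bigr do rewrite mulr_sumr.
rewrite exchange_big; apply: eq_bigr => k _; rewrite mulr_sumr.
by apply: eq_bigr => l _; rewrite mderiv_comm mulrCA.
Qed.

Lemma enorm_lamE x :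
  peval p e * enorm (lam S x) ^+ 2 = peval p e * htr S x ^+ 2 - bil x x.
Proof.
have [_ _ E2] := coef_prod_1subZX (eig x).
rewrite -coef2_pencil pencilE coefZ [2 * _]mulrCA E2 htr_eig enorm_lam; ring.
Qed.

(** The squared norm is the quadratic form [tr^2 - bil / p(e)] by [enorm_lamE], so polarizing it
    gives a bilinear form. Symmetry and linearity of [hip] are read off from the right-hand side. *)
Lemma hipE x y : peval p e * hip S x y = peval p e * (htr S x * htr S y) - bil x y.
Proof.
have bD u v w : bil (u + v) w = bil u w + bil v w.
  by rewrite -[u]scale1r bil_linearl mul1r scale1r.
have bN u w : bil (- u) w = - bil u w.
  have := bil_linearl (-1) u 0 w; rewrite addr0 scaleN1r mulN1r => ->.
  have := bil_linearl (-1) 0 0 w; rewrite addr0 scaler0 mulN1r => ->.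
  by rewrite addNr addr0.
have tD u v : htr S (u + v) = htr S u + htr S v.
  by have := htr_is_linear 1 u v; rewrite scale1r mul1r.
have tN u v : htr S (u - v) = htr S u - htr S v.
  by have := htr_is_linear (-1) v u; rewrite scaleN1r mulN1r addrC => ->; rewrite addrC.
suff polarize (a b c t u k l m : R) : c * a = c * (t + u) ^+ 2 - (k + l + (l + m)) ->
    c * b = c * (t - u) ^+ 2 - (k - l + (- l + m)) ->
    c * (4^-1 * (a - b)) = c * (t * u) - l.
  apply: (polarize _ _ _ _ _ (bil x x) _ (bil y y)); rewrite enorm_lamE.
    by rewrite tD !bD ![bil _ (_ + _)]bilC !bD [bil y x]bilC.
  by rewrite tN !bD ![bil _ (_ - _)]bilC !bD !bN ![bil _ (- _)]bilC !bN opprK [bil y x]bilC.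
by move=> E1 E2; rewrite mulrCA mulrBr E1 E2; field.
Qed.

Lemma hip_self x : hip S x x = enorm (lam S x) ^+ 2.
Proof.
by apply: (mulfI (hpoly_unit_neq0 S)); rewrite hipE enorm_lamE expr2.
Qed.

Lemma hipC x y : hip S x y = hip S y x.
Proof.
apply: (mulfI (hpoly_unit_neq0 S)); apply: etrans (hipE x y) _.
by apply: etrans (esym (hipE y x)); rewrite (bilC x y) (mulrC (htr S x)).
Qed.

Lemma hip_linearl (c : R) x y z : hip S (c *: x + y) z = c * hip S x z + hip S y z.
Proof.
apply: linear_cancel (hpoly_unit_neq0 S) (hipE _ _) (hipE _ _) (hipE _ _) _.
rewrite htr_is_linear bil_linearl.
move: (bil x z) (bil y z) (htr S x) (htr S y) (htr S z) (peval p e) => k l t u v d.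
ring.
Qed.

Lemma eig_unit : perm_eq (eig e) (nseq n 1).
Proof.
apply: (@perm_eig e _ (peval p e)); first exact: hpoly_unit_neq0.
apply: eq_poly_horner_neq0 => s _.
rewrite horner_line_poly -[X in _ - X]scale1r -scalerBl.
rewrite (peval_scale _ _ (hpoly_homog S)) hornerZ horner_prod mulrC.
by rewrite big_nseq iter_mulr_1 !hornerE.
Qed.

End Hyperbolic.

(** * Lipschitz estimates and continuity of roots over the complex numbers *)

Section ComplexNorm.
Variable R : realType.
Local Notation C := R[i].
Local Notation nc := (@normc R).
Implicit Types z w : C.

Lemma normc_ge0 z : 0 <= nc z.
Proof. by case: z => a b; apply: sqrtr_ge0. Qed.

Lemma normc_real (x : R) : nc x%:C%C = `|x|.
Proof. by rewrite /= expr0n addr0 sqrtr_sqr. Qed.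

Lemma ler_Im_normc z : `|complex.Im z| <= nc z.
Proof. by case: z => a b /=; rewrite -sqrtr_sqr ler_sqrt ?addr_ge0 ?lerDr ?sqr_ge0. Qed.

Lemma normc_eq0 z : (nc z == 0) = (z == 0).
Proof. by apply/eqP/eqP => [/eq0_normc //|->]; exact: normc0. Qed.

Lemma normc_prod (T : Type) (s : seq T) (F : T -> C) :
  nc (\prod_(z <- s) F z) = \prod_(z <- s) nc (F z).
Proof. exact: (big_morph nc (@normcM R) (normc1 R)). Qed.

(* Bounded and Lipschitz on every bidisc; unlike being Lipschitz there, this is *)
(* stable under products.                                                       *)
Definition lip2 (f : C -> C -> C) : Prop :=
  forall r : R, exists L : R, forall z1 w1 z2 w2,
    nc z1 <= r -> nc w1 <= r -> nc z2 <= r -> nc w2 <= r ->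
    nc (f z1 w1) <= L /\
    nc (f z1 w1 - f z2 w2) <= L * (nc (z1 - z2) + nc (w1 - w2)).

Lemma lip2_ext f g : (forall z w, f z w = g z w) -> lip2 f -> lip2 g.
Proof.
move=> fg lf r; have [L HL] := lf r; exists L => z1 w1 z2 w2 ? ? ? ?.
by rewrite -!fg; apply: HL.
Qed.

Lemma lip2_cst c : lip2 (fun _ _ => c).
Proof.
move=> r; exists (nc c) => z1 w1 z2 w2 *; split => //.
by rewrite subrr normc0 mulr_ge0 ?addr_ge0 ?normc_ge0.
Qed.

Lemma lip2_fst : lip2 (fun z _ => z).
Proof.
move=> r; exists (1 + r) => z1 w1 z2 w2 hz1 *.
have := normc_ge0 z1; have := normc_ge0 (z1 - z2); have := normc_ge0 (w1 - w2).
move: hz1; move: (nc z1) (nc (z1 - z2)) (nc (w1 - w2)) => a b d *.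
split; nra.
Qed.

Lemma lip2_snd : lip2 (fun _ w => w).
Proof.
move=> r; have [L HL] := lip2_fst r; exists L => z1 w1 z2 w2 *.
by rewrite [X in _ * X]addrC; apply: HL.
Qed.

Lemma lip2D f g : lip2 f -> lip2 g -> lip2 (fun z w => f z w + g z w).
Proof.
move=> lf lg r; have [L HL] := lf r; have [M HM] := lg r.
exists (L + M) => z1 w1 z2 w2 h1 h2 h3 h4.
have [A1 A2] := HL _ _ _ _ h1 h2 h3 h4; have [B1 B2] := HM _ _ _ _ h1 h2 h3 h4.
split; first by apply: le_trans (le_normcD _ _) _; apply: lerD.
rewrite opprD addrACA mulrDl; apply: le_trans (le_normcD _ _) _; exact: lerD.
Qed.

Lemma lip2M f g : lip2 f -> lip2 g -> lip2 (fun z w => f z w * g z w).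
Proof.
move=> lf lg r; have [L HL] := lf r; have [M HM] := lg r.
exists (L * M + (M * L)) => z1 w1 z2 w2 h1 h2 h3 h4.
have [A1 A2] := HL _ _ _ _ h1 h2 h3 h4; have [B1 B2] := HM _ _ _ _ h1 h2 h3 h4.
have [B3 _] := HM _ _ _ _ h3 h4 h1 h2.
have L0 : 0 <= L := le_trans (normc_ge0 _) A1.
have M0 : 0 <= M := le_trans (normc_ge0 _) B1.
split.
  rewrite normcM; apply: le_trans (_ : L * M <= _); last by rewrite lerDl mulr_ge0.
  by apply: ler_pM => //; apply: normc_ge0.
have -> : f z1 w1 * g z1 w1 - f z2 w2 * g z2 w2 =
  f z1 w1 * (g z1 w1 - g z2 w2) + g z2 w2 * (f z1 w1 - f z2 w2) by ring.
apply: le_trans (le_normcD _ _) _; rewrite !normcM mulrDl -!mulrA.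
by apply: lerD; apply: ler_pM => //; apply: normc_ge0.
Qed.

Lemma lip2X f k : lip2 f -> lip2 (fun z w => f z w ^+ k).
Proof.
move=> lf; elim: k => [|k IH]; first exact: lip2_cst.
by apply: lip2_ext (lip2M lf IH) => z w; rewrite exprS.
Qed.

Lemma lip2_sum (T : Type) (s : seq T) (F : T -> C -> C -> C) :
  (forall i, lip2 (F i)) -> lip2 (fun z w => \sum_(i <- s) F i z w).
Proof.
move=> lF; elim: s => [|i s IH].
  by apply: lip2_ext (lip2_cst 0) => z w; rewrite big_nil.
by apply: lip2_ext (lip2D (lF i) IH) => z w; rewrite big_cons.
Qed.

Lemma lip2_prod (T : Type) (s : seq T) (F : T -> C -> C -> C) :
  (forall i, lip2 (F i)) -> lip2 (fun z w => \prod_(i <- s) F i z w).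
Proof.
move=> lF; elim: s => [|i s IH].
  by apply: lip2_ext (lip2_cst 1) => z w; rewrite big_nil.
by apply: lip2_ext (lip2M (lF i) IH) => z w; rewrite big_cons.
Qed.

Lemma lip2_mmap (d : nat) (q : {mpoly R[d]}) (h : 'I_d -> C -> C -> C) :
  (forall i, lip2 (h i)) ->
  lip2 (fun z w => mmap (real_complex R) (fun i => h i z w) q).
Proof.
move=> lh; rewrite /mmap; apply: lip2_sum => m; apply: lip2M; first exact: lip2_cst.
by apply: lip2_prod => i; apply: lip2X.
Qed.

Lemma lip2_poly (q : {poly C}) f : lip2 f -> lip2 (fun z w => q.[f z w]).
Proof.
move=> lf; have := lip2_sum (index_enum 'I_(size q))
  (fun i : 'I_(size q) => lip2M (lip2_cst q`_i) (lip2X i lf)).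
by apply: lip2_ext => z w; rewrite horner_coef.
Qed.

(* The roots stay in the lower half-plane: being at distance at least [k / L]   *)
(* from the real axis for every value of the parameter, they cannot cross it in *)
(* steps of uniformly small size.                                               *)
Lemma lower_roots_homotopy (H : C -> C -> C) (c : C) (n : nat) (k r0 : R) :
  c != 0 -> 0 < k -> lip2 H ->
  (forall r : R, exists2 zs, size zs = n &
     forall s, H s r%:C%C = c * \prod_(z <- zs) (s - z)) ->
  (forall x r : R, 0 <= r <= 1 -> k <= nc (H x%:C%C r%:C%C)) ->
  (forall (s : C) (r : R), 0 <= r <= 1 -> H s r%:C%C = 0 -> nc s <= r0) ->
  (forall s, H s 0 = 0 -> complex.Im s < 0) ->
  forall s, H s 1 = 0 -> complex.Im s < 0.
Proof.
move=> nzc k0 lH Hfac Hk Hr0 H0.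
have [L HL] := lH (Num.max r0 1).
have maxl : r0 <= Num.max r0 1 by rewrite le_max lexx.
have maxr (r : R) : 0 <= r <= 1 -> nc r%:C%C <= Num.max r0 1.
  by move=> /andP[r0' r1]; rewrite normc_real ger0_norm // le_max r1 orbT.
have [L0 rootgap] : 0 < L /\ forall (s : C) (r : R), 0 <= r <= 1 ->
    H s r%:C%C = 0 -> k <= L * `|complex.Im s|.
  (* A root is compared with its real part: there [H] has modulus at least [k], and it is only
     [|Im s|] away. *)
  have gap (s : C) (r : R) : 0 <= r <= 1 ->
    H s r%:C%C = 0 -> k <= L * `|complex.Im s|.
    move=> r01 Hs; apply: le_trans (Hk (complex.Re s) _ r01) _.
    have ns := Hr0 _ _ r01 Hs.
    have nRe : nc (complex.Re s)%:C%C <= Num.max r0 1.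
      apply: le_trans maxl; apply: le_trans ns.
      rewrite normc_real; case: (s) => a b /=.
      by rewrite -sqrtr_sqr ler_sqrt ?addr_ge0 ?lerDl ?sqr_ge0.
    have [_] := HL _ _ _ _ nRe (maxr _ r01) (le_trans ns maxl) (maxr _ r01).
    rewrite Hs subr0 subrr normc0 addr0.
    suff -> : nc ((complex.Re s)%:C%C - s) = `|complex.Im s| by [].
    by case: (s) => a b /=; rewrite subrr expr0n add0r sub0r sqrrN sqrtr_sqr.
  split=> //.
  have z01 : 0 <= (0 : R) <= 1 by rewrite lexx ler01.
  have n0 : nc 0%:C%C <= Num.max r0 1 by apply: maxr.
  have [] := HL _ _ _ _ n0 n0 n0 n0; have := Hk 0 0 z01.
  by move=> k1 k2 _; apply: lt_le_trans k0 (le_trans k1 k2).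
pose dl := k / L; have dl0 : 0 < dl by rewrite divr_gt0.
have lower (s : C) (r : R) : 0 <= r <= 1 -> H s r%:C%C = 0 ->
    complex.Im s < 0 -> complex.Im s <= - dl.
  move=> r01 Hs Ims; have := rootgap _ _ r01 Hs.
  by rewrite (ltr0_norm Ims) mulrC -ler_pdivrMr // -/dl lerNr.
have nc0 : 0 < nc c by rewrite lt0r normc_eq0 nzc normc_ge0.
(* Lower bound for [|H|] on the closed upper half-plane when all [n] roots have imaginary part at
   most [- dl]. *)
pose m := nc c * dl ^+ n.
have m0 : 0 < m by rewrite mulr_gt0 // exprn_gt0.
(* Since [L / N < m], moving the parameter by [1 / N] cannot create a zero where [|H| >= m]. *)
have [N HN] : exists N : nat, L / m < N%:R.
  by exists (Num.bound (L / m)); apply: archi_boundP; rewrite divr_ge0 // ltW.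
have N0 : 0 < N%:R :> R by apply: le_lt_trans HN; rewrite divr_ge0 // ltW.
have stp (j : nat) : (j <= N)%N -> 0 <= (j%:R / N%:R : R) <= 1.
  by move=> jN; rewrite divr_ge0 ?ler0n //= ler_pdivrMr // mul1r ler_nat.
have main (j : nat) : (j <= N)%N -> forall s, H s (j%:R / N%:R)%:C%C = 0 -> complex.Im s < 0.
  elim: j => [_ s|j IH jN s Hs]; first by rewrite mul0r; apply: H0.
  rewrite ltNge; apply/negP => Ims.
  have [zs szs Ezs] := Hfac (j%:R / N%:R).
  have zlow z : z \in zs -> complex.Im z <= - dl.
    move=> zzs; have Hz : H z (j%:R / N%:R)%:C%C = 0.
      rewrite Ezs; apply/eqP; rewrite mulf_eq0 prodf_seq_eq0; apply/orP; right.
      by apply/hasP; exists z => //=; rewrite subrr.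
    by apply: lower Hz (IH (ltnW jN) _ Hz); apply: stp; apply: ltnW.
  have big_low : m <= nc (H s (j%:R / N%:R)%:C%C).
    rewrite Ezs normcM normc_prod /m ler_pM2l // -szs.
    rewrite -[X in dl ^+ X]count_predT -iter_mulr_1 -(big_const_seq 1 *%R).
    rewrite big_seq [X in _ <= X]big_seq; apply: ler_prod => z zzs.
    rewrite ltW //= ; apply: le_trans (ler_Im_normc _); apply: le_trans (ler_norm _).
    have := zlow z zzs; rewrite raddfB /= => Imz.
    by rewrite -[dl]add0r lerD // lerNr.
  have ns := le_trans (Hr0 _ _ (stp _ jN) Hs) maxl.
  have [_] := HL _ _ _ _ ns (maxr _ (stp _ (ltnW jN))) ns (maxr _ (stp _ jN)).
  rewrite Hs subr0 subrr normc0 add0r -rmorphB normc_real -mulrBl -natr1 opprD addrA.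
  rewrite subrr add0r mulN1r normrN ger0_norm ?invr_ge0 ?ler0n // => /(le_trans big_low).
  by apply/negP; rewrite -ltNge ltr_pdivrMr // mulrC -ltr_pdivrMr.
by move=> s Hs; apply: (main N) => //; rewrite divff // gt_eqF.
Qed.

End ComplexNorm.

(** * Stability: roots in a positive direction lie in the lower half-plane *)

Section Stability.
Variables (R : realType) (V : vectType R) (n : nat) (S : hypSystem V n).
Local Notation p := (hpoly S).
Local Notation e := (hunit S).
Local Notation C := R[i].
Local Notation nc := (@normc R).
Local Notation rc := (real_complex R).
Local Notation cc x i := (coord (vbasis {:V}) i x)%:C%C.
Implicit Types (x y a b : V) (q : polyOn V) (s t z w : C).

Lemma mmap_real_complex q x : mmap rc (fun i => cc x i) q = (peval q x)%:C%C.
Proof. by rewrite /peval /meval [RHS](rmorph_mmap rc). Qed.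

Lemma mmap_complex_line q x t :
  mmap rc (fun i => t * cc e i - cc x i) q = (map_poly rc (line_poly q e x)).[t].
Proof.
have -> : map_poly rc (line_poly q e x) = mmap (@polyC C \o rc)
    (fun i => (cc e i)%:P * 'X - (cc x i)%:P) q.
  rewrite /line_poly [LHS](rmorph_mmap (map_poly rc)); apply: eq_mmap => i /=.
    by rewrite map_polyC.
  by rewrite rmorphB rmorphM /= map_polyX !map_polyC.
rewrite -[RHS]/(horner_eval t _) rmorph_mmap; apply: eq_mmap => i /=.
  by rewrite /horner_eval hornerC.
by rewrite /horner_eval !hornerE mulrC.
Qed.

Lemma horner_complex_line x t : (map_poly rc (line_poly p e x)).[t] =
  (peval p e)%:C%C * \prod_(z <- eig S x) (t - z%:C%C).
Proof.
rewrite line_polyE map_polyZ /= hornerZ rmorph_prod horner_prod.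
by congr (_ * _); apply: eq_bigr => z _; rewrite rmorphB /= map_polyX map_polyC !hornerE.
Qed.

Lemma complex_line_neq0 x t : 0 < complex.Im t -> (map_poly rc (line_poly p e x)).[t] != 0.
Proof.
move=> t0; rewrite horner_complex_line mulf_eq0 fmorph_eq0 negb_or hpoly_unit_neq0 /=.
rewrite prodf_seq_neq0; apply/allP => z _ /=; apply: contraTneq t0.
by move=> /(congr1 (@complex.Im R)); rewrite raddfB /= subr0 => ->; rewrite ltxx.
Qed.

Lemma peval_neq0 a : all (fun l : R => 0 < l) (eig S a) -> peval p a != 0.
Proof.
move=> a0; have := peval_scale (-1) a (hpoly_homog S).
rewrite scaleN1r -[- a]add0r -[X in X - a](scale0r e) -horner_line_poly line_polyE.
move=> E; suff : (-1) ^+ n * peval p a != 0 by apply: contraNneq => ->; rewrite mulr0.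
rewrite -E hornerZ horner_prod mulf_neq0 ?hpoly_unit_neq0 //.
rewrite prodf_seq_neq0; apply: sub_all a0 => z /= z0.
by rewrite !hornerE oppr_eq0 gt_eqF.
Qed.

Lemma mmap_affine_factor a (u : 'I_(\dim {:V}) -> C) : peval p a != 0 ->
  exists2 zs, size zs = n &
    mmap (@polyC C \o rc) (fun i => (u i)%:P + (cc a i)%:P * 'X) p =
    (peval p a)%:C%C *: \prod_(z <- zs) ('X - z%:P).
Proof.
move=> nza.
have [sz cf] := size_coef_mmap_affine rc u (fun i => cc a i) (hpoly_homog S).
set q := mmap _ _ p in sz cf *; rewrite mmap_real_complex in cf.
have nzc : (peval p a)%:C%C != 0 :> C by rewrite fmorph_eq0.
have szq : size q = n.+1.
  apply/eqP; rewrite eqn_leq sz /= ltnNge; apply: contraNN nzc => sz'.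
  by rewrite -cf nth_default.
have [zs Ezs] := closed_field_poly_normal q.
have lc : lead_coef q = (peval p a)%:C%C by rewrite lead_coefE szq.
exists zs; last by rewrite -lc.
move: szq; rewrite Ezs lc size_scale // size_prod_XsubC; by case.
Qed.

Lemma horner_mmap_affine a (u : 'I_(\dim {:V}) -> C) s :
  (mmap (@polyC C \o rc) (fun i => (u i)%:P + (cc a i)%:P * 'X) p).[s] =
  mmap rc (fun i => u i + s * cc a i) p.
Proof.
rewrite -[LHS]/(horner_eval s _) rmorph_mmap; apply: eq_mmap => i /=.
  by rewrite /horner_eval hornerC.
by rewrite /horner_eval !hornerE mulrC.
Qed.

(** Deform [y] to 0 through [w y] with [w] in [[0, 1]] and apply [lower_roots_homotopy]. *)
Lemma stable_i a y s : all (fun l : R => 0 < l) (eig S a) ->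
  mmap rc (fun i => 'i%C * cc e i + cc y i + s * cc a i) p = 0 ->
  complex.Im s < 0.
Proof.
move=> a0 Hs.
have nza := peval_neq0 a0.
have nzpe : 0 < nc (peval p e)%:C%C.
  by rewrite lt0r normc_ge0 normc_eq0 fmorph_eq0 hpoly_unit_neq0.
pose H (z w : C) := mmap rc (fun i => 'i%C * cc e i + w * cc y i + z * cc a i) p.
have lipH : lip2 H.
  apply: lip2_mmap => i; apply: lip2D; last first.
    by apply: lip2M; [exact: lip2_fst | exact: lip2_cst].
  by apply: lip2D; [exact: lip2_cst | apply: lip2M; [exact: lip2_snd | exact: lip2_cst]].
(* [H] reversed in [z]; it equals [p(a) != 0] at [z = 0], which keeps the roots of [H] bounded. *)
pose G (z w : C) := mmap rc (fun i => cc a i + z * ('i%C * cc e i + w * cc y i)) p.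
have lipG : lip2 G.
  apply: lip2_mmap => i; apply: lip2D; first exact: lip2_cst.
  apply: lip2M; first exact: lip2_fst.
  by apply: lip2D; [exact: lip2_cst | apply: lip2M; [exact: lip2_snd | exact: lip2_cst]].
have HG z w : z != 0 -> H z w = z ^+ n * G z^-1 w.
  move=> nz; rewrite /G -(mmap_homog_scale rc _ _ (hpoly_homog S)).
  by apply: eq_mmap => // i; rewrite mulrDr mulrA divff // mul1r addrC.
have nzpa : 0 < nc (peval p a)%:C%C by rewrite lt0r normc_ge0 normc_eq0 fmorph_eq0 nza.
have [L HL] := lipG 1.
(* A zero of [H] with [|z| > 1] gives [G(1/z) = 0], hence [|p(a)| = |G(0) - G(1/z)| <= L / |z|]. *)
pose r0 := Num.max 1 (L / nc (peval p a)%:C%C).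
apply: (@lower_roots_homotopy R H (peval p a)%:C%C n (nc (peval p e)%:C%C) r0) => //.
- by rewrite fmorph_eq0.
- move=> r; have [zs szs Ezs] :=
    mmap_affine_factor (fun i => 'i%C * cc e i + r%:C%C * cc y i) nza.
  exists zs => // z; rewrite /H -horner_mmap_affine Ezs hornerZ horner_prod.
  by congr (_ * _); apply: eq_bigr => w _; rewrite !hornerE.
(* For real [x] the argument is [i e] minus a real vector, so [p] factors as [p(e)] times factors
   [i - z] with [z] real, each of modulus at least 1. *)
- move=> x r _; have -> : H x%:C%C r%:C%C =
    mmap rc (fun i => 'i%C * cc e i - cc (- (r *: y + x *: a)) i) p.
    apply: eq_mmap => // i.
    by rewrite linearN linearD !linearZ /= rmorphN opprK rmorphD !rmorphM addrA.
  rewrite mmap_complex_line horner_complex_line normcM ler_pMr // normc_prod.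
  elim: (eig _ _) => [|z zs IH]; rewrite ?big_nil ?big_cons //.
  rewrite -[X in X <= _]mulr1 ler_pM //; apply: le_trans (ler_Im_normc _).
  by rewrite raddfB /= subr0 normr1.
- move=> z r /andP[r0' r1] Hz; rewrite le_max; case: leP => //= z1.
  have z0 : z != 0 by apply: contraTneq z1 => ->; rewrite normc0 -leNgt ler01.
  rewrite ler_pdivlMr //.
  have ns : nc z^-1 <= 1 by rewrite normcV invf_le1 ?ltW // (lt_trans ltr01).
  have nr : nc r%:C%C <= 1 by rewrite normc_real ger0_norm.
  have n0 : nc 0 <= 1 by rewrite normc0.
  have [_] := HL _ _ _ _ ns nr n0 nr; rewrite subr0 subrr normc0 addr0.
  have -> : G z^-1 r%:C%C = 0.
    by apply/eqP; move: Hz; rewrite HG // => /eqP; rewrite mulf_eq0 expf_eq0 (negbTE z0) andbF.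
  have -> : G 0 r%:C%C = (peval p a)%:C%C.
    by rewrite -mmap_real_complex; apply: eq_mmap => // i; rewrite mul0r addr0.
  rewrite sub0r normcN normcV ler_pdivlMr 1?mulrC //.
  exact: lt_trans ltr01 z1.
- move=> z; have [->|nz] := eqVneq z 0.
    have -> : H 0 0 = mmap rc (fun i => 'i%C * cc e i) p.
      by apply: eq_mmap => // i; rewrite !mul0r !addr0.
    rewrite (mmap_homog_scale rc _ _ (hpoly_homog S)) mmap_real_complex => /eqP.
    rewrite mulf_eq0 expf_eq0 fmorph_eq0 (negbTE (hpoly_unit_neq0 S)) orbF.
    by rewrite -normc_eq0 /= expr0n expr1n add0r sqrtr1 oner_eq0 andbF.
  (* At parameter 0 a root [z] makes [b = - i / z] an eigenvalue of [a]; thus [b > 0] and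
     [z = - i / b]. *)
  have -> : H z 0 = (- z) ^+ n * mmap rc (fun i => - 'i%C / z * cc e i - cc a i) p.
    rewrite -(mmap_homog_scale rc _ _ (hpoly_homog S)); apply: eq_mmap => // i.
    by rewrite mul0r addr0; field.
  move=> /eqP; rewrite mulf_eq0 expf_eq0 oppr_eq0 (negbTE nz) andbF /=.
  rewrite mmap_complex_line horner_complex_line mulf_eq0 fmorph_eq0.
  rewrite (negbTE (hpoly_unit_neq0 S)) /= prodf_seq_eq0 => /hasP[b ba /=].
  rewrite subr_eq0 => /eqP Eb; have b0 : 0 < b := allP a0 _ ba.
  have -> : z = - 'i%C * (b^-1)%:C%C.
    have nzb : b%:C%C != 0 :> C by rewrite fmorph_eq0 gt_eqF.
    apply: (mulIf nzb); rewrite -mulrA -rmorphM mulVf ?gt_eqF // rmorph1 mulr1 -Eb.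
    by field.
  by rewrite /= mulr0 add0r mulN1r oppr_lt0 invr_gt0.
by rewrite -Hs /H; apply: eq_mmap => // i; rewrite mul1r.
Qed.

(** Dividing by [v = Im t] normalizes [t] to [i]; its real part is absorbed into the real vector of
    [stable_i]. *)
Lemma stable a x t s : all (fun l : R => 0 < l) (eig S a) -> 0 < complex.Im t ->
  mmap rc (fun i => t * cc e i - cc x i + s * cc a i) p = 0 -> complex.Im s < 0.
Proof.
move=> a0; case: t => u v /= v0 Hs.
have nzv : v%:C%C != 0 :> C by rewrite fmorph_eq0 gt_eqF.
have /(stable_i a0) : mmap rc (fun i => 'i%C * cc e i +
    cc (v^-1 *: (u *: e - x)) i + (v^-1)%:C%C * s * cc a i) p = 0.
  apply/eqP; have := Hs; rewrite -[X in X = 0 -> _]mulr1.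
  rewrite (eq_mmap (g := rc) (k := fun i => v%:C%C * ('i%C * cc e i +
    cc (v^-1 *: (u *: e - x)) i + (v^-1)%:C%C * s * cc a i))) // => [|i].
    rewrite mulr1 (mmap_homog_scale rc _ _ (hpoly_homog S)) => /eqP.
    by rewrite mulf_eq0 expf_eq0 (negbTE nzv) andbF.
  have -> : (u +i* v)%C = u%:C%C + v%:C%C * 'i%C :> C.
    by apply/eqP; rewrite eq_complex /= !(mul0r, mulr0, mulr1, subr0, addr0, add0r) !eqxx.
  rewrite linearZ linearB linearZ /= rmorphM rmorphB rmorphM fmorphV; field.
  exact: nzv.
have -> : complex.Im ((v^-1)%:C%C * s) = v^-1 * complex.Im s.
  by case: (s) => ? ? /=; rewrite mul0r addr0.
by rewrite pmulr_rlt0 // invr_gt0.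
Qed.

End Stability.

(** * Rational maps of the upper half-plane into the lower one, and partial fractions *)

Section Residues.
Variable R : realType.
Local Notation C := R[i].
Local Notation nc := (@normc R).
Local Notation rc := (real_complex R).
Implicit Types (f g : {poly R}) (r : R) (s : seq R) (z w t : C).

Lemma Im_inv_le0 z : 0 <= complex.Im z -> complex.Im z^-1 <= 0.
Proof.
case: z => a b /= b0; rewrite oppr_le0 divr_ge0 //.
by rewrite addr_ge0 ?sqr_ge0.
Qed.

(** The logarithmic derivative is the sum of the [1 / (t - z)], and each [t - z] has positive
    imaginary part. *)
Lemma lower_roots_log_deriv (zs : seq C) (c t : C) : c != 0 ->
  (forall z, z \in zs -> complex.Im z < complex.Im t) ->
  complex.Im ((c *: \prod_(z <- zs) ('X - z%:P))^`().[t] /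
              (c *: \prod_(z <- zs) ('X - z%:P)).[t]) <= 0.
Proof.
move=> nzc hz; rewrite derivZ !hornerZ -mulf_div divff // mul1r.
elim: zs hz => [|z zs IH] hz; first by rewrite big_nil derivC horner0 mul0r.
have tz : t - z != 0.
  rewrite subr_eq0; apply: contraTneq (hz z (mem_head _ _)) => ->.
  by rewrite ltxx.
have nzP : (\prod_(z <- zs) ('X - z%:P)).[t] != 0.
  rewrite horner_prod prodf_seq_neq0; apply/allP => w wzs /=.
  rewrite !hornerE subr_eq0; apply: contraTneq (hz w _) => [->|].
    by rewrite ltxx.
  by rewrite inE wzs orbT.
rewrite big_cons derivM derivB derivX derivC subr0 mul1r !hornerE.
rewrite [X in X / _]addrC mulrDl -mulf_div divff // mul1r invfM [X in _ + X]mulrCA divff //.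
rewrite mulr1 raddfD /=; apply: le_trans (_ : 0 + 0 <= _); last by rewrite addr0.
apply: lerD; first by apply: IH => w wzs; apply: hz; rewrite inE wzs orbT.
by apply: Im_inv_le0; rewrite raddfB /= subr_ge0 ltW // hz ?mem_head.
Qed.

Lemma lip2_Im_le0 (f : C -> C -> C) : lip2 f ->
  (forall r, 0 < r -> complex.Im (f r%:C%C 0) <= 0) -> complex.Im (f 0 0) <= 0.
Proof.
move=> /(_ 1)[L HL] hf; rewrite leNgt; apply/negP => f0.
have n0 : nc 0 <= 1 by rewrite normc0.
pose L' := Num.max L (complex.Im (f 0 0)).
have L'0 : 0 < L' by rewrite lt_max f0 orbT.
(* Between 0 and this [r] the Lipschitz bound lets [f] move by at most half of [Im (f 0 0)]. *)
pose r := complex.Im (f 0 0) / (2 * L').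
have r0 : 0 < r by rewrite divr_gt0 // mulr_gt0.
have r1 : r <= 1.
  rewrite ler_pdivrMr ?mulr_gt0 // mul1r; apply: le_trans (_ : L' <= _).
    by rewrite le_max lexx orbT.
  by move: L'0; lra.
have nr : nc r%:C%C <= 1 by rewrite normc_real gtr0_norm.
have [_] := HL _ _ _ _ n0 n0 nr n0; rewrite sub0r normcN normc_real gtr0_norm //.
rewrite subrr normc0 addr0 => hL.
have := le_trans (ler_norm _) (le_trans (ler_Im_normc _) hL).
rewrite raddfB /= => {}hL.
have hL' : L * r <= L' * r by rewrite ler_pM2r // le_max lexx.
have E : L' * r = complex.Im (f 0 0) / 2 by rewrite /r; field; rewrite gt_eqF.
have := hf r r0; rewrite E in hL'; lra.
Qed.

(* The sign of the imaginary part of [w ^- k * c] can be chosen freely by     *)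
(* rotating [w] within the upper half-plane, except when [k = 1].             *)
Lemma rotate_pole (k : nat) (c : R) : c != 0 -> (0 < k)%N -> (k == 1%N) ==> (c < 0) ->
  exists2 w, 0 < complex.Im w & 0 < complex.Im (w ^- k * c%:C%C).
Proof.
move=> nzc; case: k => [//|[_ /= c0|k _ _]].
  exists 'i%C; first exact: ltr01.
  by rewrite expr1 /= expr0n /= expr1n add0r !(mul0r, mulr0, mulr1, divr1, mulN1r, add0r) oppr_gt0.
pose w := k.+2.-root (- 'i%C * c%:C%C).
have wk : w ^+ k.+2 = - 'i%C * c%:C%C by rewrite rootCK.
have w0 : 0 <= complex.Im w by rewrite -ler0c complexIm Im_rootC_ge0.
have nzw : complex.Im w != 0.
  apply: contraNneq nzc => Iw.
  have Ew : w = (complex.Re w)%:C%C.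
    by apply/eqP; rewrite eq_complex /= Iw !eqxx.
  move: wk; rewrite Ew -rmorphXn /= => /(congr1 (@complex.Im R)) /=.
  by rewrite mulr0 add0r mulN1r => /eqP; rewrite eq_sym oppr_eq0.
exists w; first by rewrite lt0r nzw.
have nzcc : c%:C%C != 0 :> C by rewrite fmorph_eq0.
have nzi : 'i%C != 0 :> C by rewrite -normc_eq0 /= expr0n expr1n add0r sqrtr1 oner_eq0.
have -> : w ^- k.+2 * c%:C%C = 'i%C; last by rewrite ltr01.
rewrite wk invfM -mulrA mulVf // mulr1; apply: (mulfI nzi).
by rewrite invrN mulrN divff // -expr2 sqr_i.
Qed.

(* The hypothesis says that [g / f] maps the upper half-plane to the closed    *)
(* lower one, which forces real poles to be simple with nonnegative residues. *)
Lemma lower_map_simple_pole f g (F : {poly R}) r m : (0 < m)%N ->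
  f = ('X - r%:P) ^+ m * F -> F.[r] != 0 ->
  (forall t, 0 < complex.Im t -> (map_poly rc f).[t] != 0 /\
     complex.Im ((map_poly rc g).[t] / (map_poly rc f).[t]) <= 0) ->
  exists2 G, g = ('X - r%:P) ^+ m.-1 * G & 0 <= G.[r] / F.[r].
Proof.
move=> m0 Ef nzF hfg.
have [->|nzg] := eqVneq g 0.
  by exists 0; rewrite ?mulr0 // horner0 mul0r.
have [l [G rG Eg]] := multiplicity_XsubC g r; rewrite nzg /= in rG.
have nzG : G.[r] != 0 by [].
have [ml|lm] := leqP m l.
  (* No pole at [r]: the cofactor keeps a factor ['X - r%:P], so the residue is 0. *)
  exists (('X - r%:P) ^+ (l - m).+1 * G).
    by rewrite mulrA -exprD Eg mulrC -addSnnS prednK // subnKC.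
  by rewrite hornerM horner_exp !hornerE subrr expr0n mul0r mul0r.
have [k1|] := boolP ((m - l == 1)%N && (0 < G.[r] * F.[r])).
  exists G; first by rewrite Eg mulrC -[m](subnK (ltnW lm)); case/andP: k1 => /eqP ->.
  case/andP: k1 => _ GF; apply: ltW; rewrite -(pmulr_lgt0 _ (_ : 0 < F.[r] ^+ 2)).
    by rewrite expr2 mulrA divfK.
  by rewrite lt0r sqr_ge0 expf_neq0.
set k := (m - l)%N; set c := G.[r] * F.[r] => hk.
have nzc : c != 0 by rewrite mulf_neq0.
have k0 : (0 < k)%N by rewrite subn_gt0.
have hk' : (k == 1%N) ==> (c < 0).
  apply/implyP => k1; move: hk; rewrite k1 /= -leNgt => c0.
  by rewrite lt_neqAle nzc.
have [w w0] := rotate_pole nzc k0 hk'.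
have nzw : w != 0 by apply: contraTneq w0 => ->; rewrite ltxx.
(* At [t = r + q w] with [q > 0] real, [g / f] is a positive multiple of [psi q]: its denominator is
   made positive by the conjugate of [F], written as [F] at the conjugate point so that [psi] is
   polynomial in [z]. In the limit [psi 0 = w ^- k * c], whose imaginary part is positive by the
   choice of [w]. *)
pose psi z := w ^- k * ((map_poly rc G).[r%:C%C + z * w] *
                        (map_poly rc F).[r%:C%C + z * w^*%C]).
have lpsi : lip2 (fun z _ => psi z).
  apply: lip2M; first exact: lip2_cst.
  by apply: lip2M; apply: lip2_poly; (apply: lip2D; first exact: lip2_cst);
    apply: lip2M; [exact: lip2_fst | exact: lip2_cst | exact: lip2_fst | exact: lip2_cst].
have := lip2_Im_le0 lpsi; rewrite /psi !mul0r !addr0 !horner_map /= -rmorphM.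
move=> H; rewrite ltNge; case/negP; apply: H => q q0.
set t := r%:C%C + q%:C%C * w.
have Et : t - r%:C%C = q%:C%C * w by rewrite /t addrC addKr.
have t0 : 0 < complex.Im t.
  rewrite /t; case: (w) w0 => u v /= v0; rewrite mul0r addr0 add0r.
  by rewrite mulr_gt0.
set Ft := (map_poly rc F).[t]; set Gt := (map_poly rc G).[t].
have Ect : r%:C%C + q%:C%C * w^*%C = t^*%C.
  by rewrite /t; case: (w) => u v /=; apply/eqP; rewrite eq_complex /=;
    apply/andP; split; apply/eqP; ring.
have EF : (map_poly rc F).[t^*%C] = Ft^*%C.
  rewrite -[RHS](horner_map (@conjc R)) -map_poly_comp /=; congr (_.[_]).
  by apply: eq_map_poly => x /=; rewrite oppr0.
rewrite Ect EF.
have nzq : q%:C%C != 0 :> C by rewrite fmorph_eq0 gt_eqF.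
have [nzFt h] : Ft != 0 /\
    complex.Im ((q ^- k * nc Ft ^- 2)%:C%C * (w ^- k * (Gt * Ft^*%C))) <= 0.
  have := hfg t t0.
  have -> : (map_poly rc f).[t] = (q%:C%C * w) ^+ m * Ft.
    by rewrite Ef rmorphM rmorphXn rmorphB /= map_polyX map_polyC !hornerE Et.
  have -> : (map_poly rc g).[t] = Gt * (q%:C%C * w) ^+ l.
    by rewrite Eg rmorphM rmorphXn rmorphB /= map_polyX map_polyC !hornerE Et.
  rewrite mulf_eq0 negb_or => -[/andP[_ nzFt] h]; split=> //; move: h.
  have -> : (q ^- k * nc Ft ^- 2)%:C%C = (q%:C%C ^+ k)^-1 * (Ft * Ft^*%C)^-1.
    rewrite [LHS]rmorphM !fmorphV rmorphXn; congr (_ * _^-1); case: (Ft) => u v /=.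
    rewrite sqr_sqrtr ?addr_ge0 ?sqr_ge0 //; apply/eqP; rewrite eq_complex /=.
    by apply/andP; split; apply/eqP; ring.
  suff -> : Gt * (q%:C%C * w) ^+ l / ((q%:C%C * w) ^+ m * Ft) =
    (q%:C%C ^+ k)^-1 * (Ft * Ft^*%C)^-1 * (w ^- k * (Gt * Ft^*%C)) by [].
  rewrite -(subnK (ltnW lm)) -/k exprD !exprMn.
  have nzFc : Ft^*%C != 0 by rewrite conjc_eq0.
  field.
  by rewrite nzFt nzFc !expf_neq0.
have P0 : 0 < q ^- k * nc Ft ^- 2.
  by rewrite mulr_gt0 ?invr_gt0 ?exprn_gt0 // lt0r normc_ge0 normc_eq0 nzFt.
rewrite -(pmulr_rle0 _ P0); move: h; case: (w ^- k * _) => u v /=.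
by rewrite mul0r addr0.
Qed.

(** Powers of distinct linear factors are coprime. *)
Lemma dvdp_prod_XsubC s (P : {poly R}) :
  (forall r, r \in s -> ('X - r%:P) ^+ count_mem r s %| P) ->
  \prod_(r <- s) ('X - r%:P) %| P.
Proof.
move=> h; rewrite -prodr_undup_exp_count.
have {h} : forall r, r \in undup s -> ('X - r%:P) ^+ count_mem r s %| P.
  by move=> r; rewrite mem_undup; apply: h.
elim: (undup s) (undup_uniq s) => [|r us IH] /=; first by rewrite big_nil dvd1p.
move=> /andP[rus uus] h; rewrite big_cons Gauss_dvdp.
  rewrite h ?mem_head // IH // => q qus; apply: h; by rewrite inE qus orbT.
rewrite coprimep_expl // coprimep_sym coprimep_XsubC /root horner_prod.
rewrite prodf_seq_neq0; apply/allP => q qus /=; rewrite horner_exp !hornerE.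
by rewrite expf_neq0 // subr_eq0; apply: contraNneq rus => ->.
Qed.

Lemma prod_XsubC_split s r : \prod_(z <- s) ('X - z%:P) =
  ('X - r%:P) ^+ count_mem r s * \prod_(z <- s | z != r) ('X - z%:P).
Proof.
rewrite (bigID (pred1 r)) /=; congr (_ * _).
rewrite (eq_bigr (fun=> 'X - r%:P)) => [|z /eqP -> //].
by rewrite big_const_seq iter_mulr_1.
Qed.

Lemma horner_prod_neq s r : (\prod_(z <- s | z != r) ('X - z%:P)).[r] != 0.
Proof.
rewrite horner_prod prodf_seq_neq0; apply/allP => z _ /=; apply/implyP => zr.
by rewrite !hornerE subr_eq0 eq_sym.
Qed.

Lemma count_rem_self (T : eqType) (s : seq T) x : x \in s ->
  count_mem x (rem x s) = (count_mem x s).-1.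
Proof. by move=> xs; rewrite (permP (perm_to_rem xs)) /= eqxx. Qed.

Lemma prod_rem_split s r : r \in s -> \prod_(z <- rem r s) ('X - z%:P) =
  ('X - r%:P) ^+ (count_mem r s).-1 * \prod_(z <- s | z != r) ('X - z%:P).
Proof.
move=> rs; rewrite (prod_XsubC_split _ r) count_rem_self //; congr (_ * _).
by rewrite [RHS](perm_big _ (perm_to_rem rs)) big_cons eqxx.
Qed.

(* Hermite-Lagrange interpolation: both sides agree modulo [\prod_(r <- s) ('X - r)]. *)
Lemma partial_fractions (c : R) s g (rho : R -> R) : c != 0 -> (size g <= size s)%N ->
  (forall r, r \in s -> exists2 G, g = ('X - r%:P) ^+ (count_mem r s).-1 * G &
     G.[r] = rho r * (c * (\prod_(z <- s | z != r) ('X - z%:P)).[r])) ->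
  g = \sum_(r <- undup s) rho r *: (c *: \prod_(z <- rem r s) ('X - z%:P)).
Proof.
move=> nzc sg hg; apply/eqP; rewrite -subr_eq0; set D := _ - _.
(* Modulo [('X - r) ^+ count_mem r s] only the term of index [r] survives, and it agrees with [g]
   there by hypothesis. *)
have dD : \prod_(z <- s) ('X - z%:P) %| D.
  apply: dvdp_prod_XsubC => r rs; rewrite /D (bigD1_seq r) ?mem_undup ?undup_uniq //=.
  rewrite opprD addrA dvdp_addl; last first.
    rewrite dvdpNr; apply: (big_ind (fun q => _ %| q)); first exact: dvdp0.
      by move=> *; apply: dvdp_add.
    move=> z zr; rewrite -!mul_polyC !dvdp_mull //.
    rewrite (prod_XsubC_split _ r); suff -> : count_mem r (rem z s) = count_mem r s.
      exact: dvdp_mulr.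
    have [zs|zs] := boolP (z \in s); last by rewrite rem_id.
    by rewrite [RHS](permP (perm_to_rem zs)) /= (negbTE zr).
  have [G -> HG] := hg r rs; rewrite prod_rem_split // scalerA scalerAr -mulrBr.
  have rs0 : (0 < count_mem r s)%N by rewrite -has_count has_pred1.
  rewrite -[X in _ ^+ X %| _](prednK rs0) exprSr dvdp_mul // dvdp_XsubCl /root.
  by rewrite hornerD hornerN hornerZ HG mulrA subrr.
apply/negPn/negP => nzD; have := dvdp_leq nzD dD.
rewrite size_prod_XsubC leqNgt ltnS => /negP; apply.
rewrite (leq_trans (size_polyD _ _)) // geq_max sg size_polyN.
apply: (leq_trans (size_sum _ _ _)); apply/bigmax_leqP_seq => r; rewrite mem_undup => rs _.
do 2!apply: (leq_trans (size_scale_leq _ _)).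
by rewrite size_prod_XsubC size_rem // prednK //; case: (s) rs.
Qed.
End Residues.

(** * Directional derivatives of [p] and their residues *)

Section Majorization.
Variables (R : realType) (V : vectType R) (n : nat) (S : hypSystem V n).
Local Notation p := (hpoly S).
Local Notation e := (hunit S).
Local Notation C := R[i].
Local Notation rc := (real_complex R).
Local Notation cc x i := (coord (vbasis {:V}) i x)%:C%C.
Implicit Types (x y a b : V) (s t z w : C).

Lemma hconeE a : hcone S a <-> all (>= 0) (eig S a).
Proof. exact: (all_lam S a (>= 0)). Qed.

Lemma perm_eig_shift a (c : R) : perm_eq (eig S (a + c *: e)) [seq l + c | l <- eig S a].
Proof.
apply: (@perm_eig _ _ _ S _ _ (peval p e)); first exact: hpoly_unit_neq0.
apply: eq_poly_horner_neq0 => t _; rewrite horner_line_poly.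
have -> : t *: e - (a + c *: e) = (t - c) *: e - a by rewrite opprD addrCA addrC scalerBl.
rewrite -horner_line_poly line_polyE !hornerZ !horner_prod big_map.
by congr (_ * _); apply: eq_bigr => z _; rewrite !hornerE opprD addrA addrAC.
Qed.

(* [t |-> D_a p (t e - x)], where [D_a] is the derivative in the direction [a]. *)
Definition dir_poly a x : {poly R} :=
  \sum_k coord (vbasis {:V}) k a *: line_poly p^`M(k) e x.

Lemma dir_polyD a b x : dir_poly (a + b) x = dir_poly a x + dir_poly b x.
Proof. by rewrite -big_split; apply: eq_bigr => k _; rewrite linearD scalerDl. Qed.

Lemma dir_polyZ (c : R) a x : dir_poly (c *: a) x = c *: dir_poly a x.
Proof. by rewrite scaler_sumr; apply: eq_bigr => k _; rewrite linearZ scalerA. Qed.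

Lemma dir_poly_unit x : dir_poly e x = (line_poly p e x)^`().
Proof.
rewrite (deriv_mmap idfun); apply: eq_bigr => k _.
by rewrite derivB derivM !derivC derivX mul0r mulr1 add0r subr0 mul_polyC.
Qed.

Lemma size_dir_poly a x : (0 < n)%N -> (size (dir_poly a x) <= n)%N.
Proof.
move=> n0; apply: (leq_trans (size_sum _ _ _)); apply/bigmax_leqP => k _.
apply: (leq_trans (size_scale_leq _ _)); rewrite -[X in (_ <= X)%N](prednK n0).
by have [] := size_coef_line_poly S x (homog_mderiv k (hpoly_homog S)).
Qed.

(** With [q(s) = p(t e - x + s a)], the quotient studied in [lower_dir] is the logarithmic
    derivative of [q] at [s = 0]. *)
Lemma horner_dir_poly a x t (q := mmap (@polyC C \o rc)
    (fun i => (t * cc e i - cc x i)%:P + (cc a i)%:P * 'X) p) :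
  q.[0] = (map_poly rc (line_poly p e x)).[t] /\
  q^`().[0] = (map_poly rc (dir_poly a x)).[t].
Proof.
split.
  rewrite /q horner_mmap_affine -mmap_complex_line; apply: eq_mmap => // i.
  by rewrite mul0r addr0.
rewrite /q deriv_mmap [X in _ = X.[t]]rmorph_sum !horner_sum; apply: eq_bigr => k _.
rewrite /= map_polyZ hornerZ hornerM -mmap_complex_line derivD derivM !derivC derivX.
rewrite mul0r !add0r mulr1 hornerC; congr (_ * _).
rewrite -[LHS]/(horner_eval 0 _) rmorph_mmap; apply: eq_mmap => i /=.
  by rewrite /horner_eval hornerC.
by rewrite /horner_eval !hornerE.
Qed.

(** The analytic trace of membership in the cone. As [dir_poly] is additive in [a], so is this
    condition, which is how partial sums of a doubly stochastic tuple are handled. *)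
Definition lower_dir a := forall x t, 0 < complex.Im t ->
  complex.Im ((map_poly rc (dir_poly a x)).[t] / (map_poly rc (line_poly p e x)).[t]) <= 0.

Lemma lower_dir_pos a : all (fun l : R => 0 < l) (eig S a) -> lower_dir a.
Proof.
move=> a0 x t t0; have nza := peval_neq0 a0.
have [<- <-] := horner_dir_poly a x t.
have [zs _ Ezs] := mmap_affine_factor (fun i => t * cc e i - cc x i) nza.
rewrite Ezs; apply: lower_roots_log_deriv; first by rewrite fmorph_eq0.
move=> z zzs; apply: (stable (x := x) a0 t0).
rewrite -(horner_mmap_affine S a) Ezs hornerZ; apply/eqP; rewrite mulf_eq0.
by apply/orP; right; rewrite -/(root _ _) root_prod_XsubC.
Qed.

Lemma lower_dirD a b : lower_dir a -> lower_dir b -> lower_dir (a + b).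
Proof.
move=> ha hb x t t0; rewrite dir_polyD rmorphD hornerD mulrDl raddfD /=.
by rewrite -[0]addr0 lerD ?ha ?hb.
Qed.

Lemma lower_dir0 : lower_dir 0.
Proof.
move=> x t _; have -> : dir_poly 0 x = 0.
  by apply: big1 => k _; rewrite linear0 scale0r.
by rewrite rmorph0 horner0 mul0r.
Qed.

(** The eigenvalues of [a + c e] are those of [a] shifted by [c > 0], hence positive; then [c] tends
    to 0. *)
Lemma lower_dir_hcone a : hcone S a -> lower_dir a.
Proof.
move=> /hconeE a0 x t t0.
set f := (map_poly rc (line_poly p e x)).[t].
set u := complex.Im (_ / f).
pose v := complex.Im ((map_poly rc (dir_poly e x)).[t] / f).
have h (c : R) : 0 < c -> u + c * v <= 0.
  move=> c0; have /lower_dir_pos : all (fun l : R => 0 < l) (eig S (a + c *: e)).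
    rewrite (perm_all _ (perm_eig_shift a c)) all_map; apply: sub_all a0 => l /= l0.
    by rewrite ltr_wpDl.
  move=> /(_ x t t0); rewrite dir_polyD dir_polyZ rmorphD /= map_polyZ hornerD hornerZ.
  rewrite mulrDl raddfD /= -mulrA -/f -/u /v; case: (_ / f) => ? ? /=.
  by rewrite mul0r addr0.
rewrite leNgt; apply/negP => u0.
have v1 : 0 < 1 + `|v| by rewrite ltr_pwDl.
(* For this [c] the product [c * v] exceeds [- u / 2], so [u + c * v] would be positive. *)
have c0 : 0 < u / 2 / (1 + `|v|) by rewrite !divr_gt0.
have := h _ c0; rewrite leNgt => /negP; apply.
have -> : u + u / 2 / (1 + `|v|) * v = u / 2 * (2 + v / (1 + `|v|)).
  by field; rewrite gt_eqF.
rewrite mulr_gt0 ?divr_gt0 //.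
suff : -1 < v / (1 + `|v|) by lra.
by rewrite ltr_pdivlMr // mulN1r; have := ler_norm (- v); rewrite normrN; lra.
Qed.

Lemma lower_dir_sum (I : Type) (r : seq I) (P : pred I) (F : I -> V) :
  (forall i, P i -> lower_dir (F i)) -> lower_dir (\sum_(i <- r | P i) F i).
Proof.
by move=> hF; apply: big_ind => //; [exact: lower_dir0|exact: lower_dirD].
Qed.

Lemma dir_poly_pole a x r : lower_dir a -> r \in eig S x ->
  exists2 G, dir_poly a x = ('X - r%:P) ^+ (count_mem r (eig S x)).-1 * G &
  0 <= G.[r] / (peval p e * (\prod_(z <- eig S x | z != r) ('X - z%:P)).[r]).
Proof.
move=> ha rx; have rs0 : (0 < count_mem r (eig S x))%N by rewrite -has_count has_pred1.
rewrite -hornerZ; apply: (lower_map_simple_pole (f := line_poly p e x)) => //.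
- by rewrite line_polyE (prod_XsubC_split _ r) -scalerAr.
- by rewrite hornerZ mulf_neq0 ?hpoly_unit_neq0 ?horner_prod_neq.
- by move=> t t0; split; [exact: complex_line_neq0 | exact: ha].
Qed.

(** The substitution [t = 1 / s] turns the expansion at infinity into the coefficients of [Q]: the
    constant one is [p(e) tr a], and the linear one is [- bil a x], which [hipE] converts into
    [hip S a x]. *)
Lemma partial_fractions_sums a x (rho : R -> R) : (0 < n)%N ->
  dir_poly a x = \sum_(r <- undup (eig S x))
     rho r *: (peval p e *: \prod_(z <- rem r (eig S x)) ('X - z%:P)) ->
  htr S a = \sum_(r <- undup (eig S x)) rho r /\
  hip S a x = \sum_(r <- undup (eig S x)) rho r * r.
Proof.
move=> n0 Edir; pose Q := \sum_k coord (vbasis {:V}) k a *: pencil p^`M(k) e x.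
have EQ : Q = \sum_(r <- undup (eig S x))
    rho r *: (peval p e *: \prod_(z <- rem r (eig S x)) (1 - z *: 'X)).
  apply: eq_poly_horner_neq0 => s nz.
  have -> : Q.[s] = s ^+ n.-1 * (dir_poly a x).[s^-1].
    rewrite /Q /dir_poly !horner_sum mulr_sumr; apply: eq_bigr => k _.
    rewrite !hornerZ horner_pencil horner_line_poly mulrCA; congr (_ * _).
    rewrite -(peval_scale _ _ (homog_mderiv k (hpoly_homog S))).
    by rewrite scalerBr scalerA divff // scale1r.
  rewrite Edir !horner_sum mulr_sumr; apply: eq_big_seq => r.
  rewrite mem_undup => rx; rewrite !hornerZ mulrCA; congr (_ * _).
  rewrite mulrCA; congr (_ * _); rewrite !horner_prod.
  have -> : n.-1 = size (rem r (eig S x)) by rewrite size_rem // size_eig.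
  rewrite -[X in s ^+ X]count_predT -iter_mulr_1 -(big_const_seq 1 *%R) -big_split /=.
  by apply: eq_bigr => z _; rewrite !hornerE mulrBr divff // mulrC.
have sum_rem r : r \in eig S x -> \sum_(z <- rem r (eig S x)) z = htr S x - r.
  by move=> rx; rewrite htr_eig (perm_big _ (perm_to_rem rx)) big_cons addrC addKr.
have tra : htr S a = \sum_(r <- undup (eig S x)) rho r.
  apply: (mulfI (hpoly_unit_neq0 S)); rewrite htrE.
  have := congr1 (fun q : {poly R} => q`_0) EQ; rewrite /Q !coef_sum mulr_sumr.
  under eq_bigr do rewrite coefZ coef0_pencil.
  move=> ->; apply: eq_bigr => r _; have [E0 _ _] := coef_prod_1subZX (rem r (eig S x)).
  by rewrite !coefZ E0 mulr1 mulrC.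
split=> //; apply: (mulfI (hpoly_unit_neq0 S)); rewrite hipE tra.
have := congr1 (fun q : {poly R} => q`_1) EQ; rewrite /Q !coef_sum.
under eq_bigr do rewrite coefZ coef1_pencil mulrN.
rewrite sumrN -/(bil S a x) => ->.
move: (peval p e) => c; rewrite mulr_suml !mulr_sumr -big_split /=.
apply: eq_big_seq => r; rewrite mem_undup => /sum_rem Er.
have [_ E1 _] := coef_prod_1subZX (rem r (eig S x)).
rewrite !coefZ E1 Er; ring.
Qed.

(** In direction [e] the quotient is the logarithmic derivative of [t |-> p(t e - x)], whose residue
    at [r] is the multiplicity of [r]. The residues of [b] and [e - b] are nonnegative and add up to
    it. *)
Lemma residue_measure b x : (0 < n)%N -> lower_dir b -> lower_dir (e - b) ->
  exists rho : R -> R,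
    [/\ forall r, r \in eig S x -> 0 <= rho r <= (count_mem r (eig S x))%:R,
        htr S b = \sum_(r <- undup (eig S x)) rho r &
        hip S b x = \sum_(r <- undup (eig S x)) rho r * r].
Proof.
move=> n0 hb hb'; set s := eig S x.
pose E r := \prod_(z <- s | z != r) ('X - z%:P).
(* The residue at [r]; for [r] in [s] the polynomial division is exact by [dir_poly_pole]. *)
pose rho r := (dir_poly b x %/ ('X - r%:P) ^+ (count_mem r s).-1).[r] / (peval p e * (E r).[r]).
have nzE r : peval p e * (E r).[r] != 0.
  by rewrite mulf_neq0 ?hpoly_unit_neq0 ?horner_prod_neq.
have nzX r : ('X - r%:P) ^+ (count_mem r s).-1 != 0 :> {poly R}.
  by rewrite expf_neq0 // polyXsubC_eq0.
have rhoE r G : dir_poly b x = ('X - r%:P) ^+ (count_mem r s).-1 * G ->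
    G.[r] = rho r * (peval p e * (E r).[r]).
  by move=> EG; rewrite /rho EG mulKp ?nzX // divfK.
exists rho; have [] := @partial_fractions_sums b x rho n0.
  apply: partial_fractions; first exact: hpoly_unit_neq0.
    by rewrite size_eig size_dir_poly.
  move=> r rs; have [G EG _] := dir_poly_pole hb rs.
  by exists G => //; apply: rhoE.
move=> -> ->; split=> // r rs.
have [G EG] := dir_poly_pole hb rs; have [G' EG'] := dir_poly_pole hb' rs.
rewrite -/(E r) (rhoE _ _ EG) mulfK // => G'0 -> /=.
set m := count_mem r s.
have m0 : (0 < m)%N by rewrite /m -has_count has_pred1.
have : ('X - r%:P) ^+ m.-1 * (G + G') =
    ('X - r%:P) ^+ m.-1 * (m%:R *: (peval p e *: E r) + ('X - r%:P) * (peval p e *: (E r)^`())).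
  rewrite mulrDr -EG -EG' -dir_polyD addrC subrK dir_poly_unit line_polyE.
  rewrite (prod_XsubC_split _ r) -/(E r) -/m derivZ derivM deriv_exp derivB derivX derivC.
  have -> : ('X - r%:P) ^+ m = ('X - r%:P) * ('X - r%:P) ^+ m.-1 by rewrite -exprS prednK.
  rewrite subr0 mul1r -[_ *+ m]mulr_natl.
  rewrite -!mul_polyC polyC_natr.
  move: (peval p e)%:P (E r) (E r)^`() ('X - r%:P) (m%:R : {poly R}) => c q q' v k.
  by move: (v ^+ m.-1) => w; ring.
move=> /(mulfI (nzX r)) /(congr1 (horner^~ r)).
rewrite !(hornerXsubC, hornerD, hornerM, hornerZ) subrr mul0r addr0 (rhoE _ _ EG) => Esum.
suff -> : rho r = m%:R - G'.[r] / (peval p e * (E r).[r]) by rewrite gerBl.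
by apply: (mulIf (nzE r)); rewrite mulrBl [G'.[r] / _ * _]divfK ?nzE // -Esum addrK.
Qed.

End Majorization.

(** * Decreasing rearrangements and majorization *)

Section Rearrangement.
Variables (R : realType) (n : nat).
Implicit Types (r s : 'cV[R]_n) (l : seq R).

Definition decr_seq r : seq R := sort >=%R [seq r j 0 | j <- enum 'I_n].

Lemma size_decr_seq r : size (decr_seq r) = n.
Proof. by rewrite size_sort size_map size_enum_ord. Qed.

Lemma mem_decr_seq r i : r i 0 \in decr_seq r.
Proof. by rewrite mem_sort; apply/map_f/mem_enum. Qed.

Lemma sorted_decr_seq r : sorted >=%R (decr_seq r).
Proof. by apply: sort_sorted => x y; apply: le_total. Qed.

Lemma sum_decr_seq r : \sum_(z <- decr_seq r) z = \sum_i r i 0.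
Proof. by rewrite (perm_big _ (permEl (perm_sort _ _))) big_map big_enum. Qed.

Lemma sum_rearr_decr r k : (k <= n)%N ->
  \sum_(i < n | (i < k)%N) rearr_decr r i 0 = \sum_(z <- take k (decr_seq r)) z.
Proof.
move=> kn; rewrite [RHS](big_nth 0) size_takel ?size_decr_seq // big_mkord.
rewrite (big_ord_widen_cond n predT (fun i => nth 0 (take k (decr_seq r)) i)) //=.
by apply: eq_bigr => i ik; rewrite mxE nth_take.
Qed.

Lemma sum_rearr_decr_all r : \sum_(i < n) rearr_decr r i 0 = \sum_i r i 0.
Proof.
rewrite -(sum_decr_seq r) -[in RHS](take_oversize (leqnn (size (decr_seq r)))).
by rewrite size_decr_seq -sum_rearr_decr //; apply: eq_bigl => i; rewrite ltn_ord.
Qed.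

Lemma sorted_nth_ge l i j : sorted >=%R l -> (i <= j)%N -> (j < size l)%N ->
  nth 0 l j <= nth 0 l i.
Proof.
move=> sl ij jl; have := sorted_leq_nth (rev_trans le_trans) (@lexx _ R) 0 sl.
by move=> h; apply: (h i j) => //; rewrite inE // (leq_ltn_trans ij).
Qed.

(** Equal totals and the inequality for the [n - 1] largest entries leave the smallest entry of [r]
    at least that of [s]. *)
Lemma majorized_ge r s (m : R) : majorized r s -> (forall i, m <= s i 0) ->
  forall i, m <= r i 0.
Proof.
move=> [hk hn] hs i; have n0 : (0 < n)%N by case: (n) i => [[]|].
have last_split (q : 'cV[R]_n) : \sum_i q i 0 =
    \sum_(z <- take n.-1 (decr_seq q)) z + nth 0 (decr_seq q) n.-1.
  rewrite -sum_decr_seq -[in LHS](cat_take_drop n.-1 (decr_seq q)) big_cat /=.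
  by rewrite (drop_nth 0) ?size_decr_seq ?prednK // drop_oversize ?size_decr_seq // big_seq1.
have le_take : \sum_(z <- take n.-1 (decr_seq r)) z <= \sum_(z <- take n.-1 (decr_seq s)) z.
  (* For [n = 1] both sums are empty; majorization only speaks of [k >= 1]. *)
  have [->|] := posnP n.-1; first by rewrite !take0 !big_nil.
  by move=> n1; rewrite -!sum_rearr_decr ?leq_pred //; apply: hk; rewrite n1 leq_pred.
move: hn; rewrite !sum_rearr_decr_all !last_split => hn.
have ms : m <= nth 0 (decr_seq s) n.-1.
  have : nth 0 (decr_seq s) n.-1 \in decr_seq s by rewrite mem_nth ?size_decr_seq ?prednK.
  by rewrite mem_sort => /mapP[j _ ->].
have mr : m <= nth 0 (decr_seq r) n.-1 by lra.
have /(nthP 0)[j] := mem_decr_seq r i; rewrite size_decr_seq => jn <-.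
apply: le_trans mr (sorted_nth_ge (sorted_decr_seq r) _ _); last by rewrite size_decr_seq prednK.
by rewrite -ltnS prednK.
Qed.

Lemma majorized_sum r s : majorized r s -> \sum_i r i 0 = \sum_i s i 0.
Proof. by case=> _; rewrite !sum_rearr_decr_all. Qed.

End Rearrangement.

(** * Both implications for a hyperbolic system *)

Section DoublyStochastic.
Variables (R : realType) (V : vectType R) (n : nat) (S : hypSystem V n).
Local Notation e := (hunit S).
Implicit Types (x y a b : V).

Lemma decr_seq_lam x : decr_seq (lam S x) = eig S x.
Proof.
rewrite /decr_seq; have -> : [seq lam S x j 0 | j <- enum 'I_n] = eig S x.
  apply: (@eq_from_nth _ 0) => [|i]; rewrite size_map size_enum_ord ?size_eig // => ni.
  by rewrite (nth_map (Ordinal ni)) ?size_enum_ord // mxE nth_enum_ord.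
by apply: sorted_sort; [exact: rev_trans le_trans | exact: sorted_zeros_decr].
Qed.

Lemma hipDl x y z : hip S (x + y) z = hip S x z + hip S y z.
Proof. by have := hip_linearl S 1 x y z; rewrite scale1r mul1r. Qed.

Lemma hip0l z : hip S 0 z = 0.
Proof. by apply: (addrI (hip S 0 z)); rewrite -hipDl !addr0. Qed.

Lemma hip_suml (I : Type) (r : seq I) (F : I -> V) z :
  hip S (\sum_(i <- r) F i) z = \sum_(i <- r) hip S (F i) z.
Proof. exact: (big_morph (fun x => hip S x z) (fun x y => hipDl x y z) (hip0l z)). Qed.

Lemma htr_sum (I : Type) (r : seq I) (F : I -> V) :
  htr S (\sum_(i <- r) F i) = \sum_(i <- r) htr S (F i).
Proof.
have htrD x y : htr S (x + y) = htr S x + htr S y.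
  by have := htr_is_linear S 1 x y; rewrite scale1r mul1r.
apply: (big_morph (htr S) htrD); have := htrD 0 0; rewrite addr0 => /eqP.
by rewrite -subr_eq0 opprD addrA subrr sub0r oppr_eq0 => /eqP.
Qed.

(** Adding or subtracting [e] shifts each eigenvalue by 1, and [((z + 1)^2 - (z - 1)^2) / 4 = z]. *)
Lemma hip_unit x : hip S x e = htr S x.
Proof.
have E (c : R) : enorm (lam S (x + c *: e)) ^+ 2 = \sum_(z <- eig S x) (z + c) ^+ 2.
  by rewrite enorm_lam (perm_big _ (perm_eig_shift S x c)) big_map.
transitivity (4^-1 * (\sum_(z <- eig S x) (z + 1) ^+ 2 - \sum_(z <- eig S x) (z - 1) ^+ 2)).
  congr (_ * (_ - _)); first by rewrite -E scale1r.
  by rewrite -E scaleN1r.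
rewrite htr_eig -sumrB mulr_sumr; apply: eq_bigr => z _; by field.
Qed.

Lemma sum_max_top (l : seq R) k : sorted >=%R l -> (0 < k <= size l)%N ->
  let th : R := nth 0 l k.-1 in
  \sum_(z <- l) Num.max (z - th) 0 = \sum_(z <- take k l) (z - th).
Proof.
move=> sl /andP[k0 kl] th; rewrite -[in LHS](cat_take_drop k l) big_cat /=.
have dropP : all (fun z => z <= th) (drop k l).
  apply/(all_nthP 0) => i; rewrite size_drop nth_drop => il.
  apply: sorted_nth_ge => //; last by rewrite -ltn_subRL.
  exact: leq_trans (leq_pred _) (leq_addr _ _).
have takeP : all (fun z => th <= z) (take k l).
  apply/(all_nthP 0) => i; rewrite size_takel // => ik; rewrite nth_take //.
  by apply: sorted_nth_ge => //; rewrite ?prednK // -ltnS prednK.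
rewrite [X in _ + X]big1_seq ?addr0; last first.
  by move=> z /andP[_ zd]; apply/max_idPr; rewrite subr_le0; exact: (allP dropP).
apply: eq_big_seq => z zt; apply/max_idPl; rewrite subr_ge0; exact: (allP takeP).
Qed.

(** The weights [rho r] sum to [k], so subtracting the [k]-th largest eigenvalue [th] from every
    eigenvalue lowers both sides by [k * th]. Then each weighted term is at most the multiplicity
    times the positive part of [r - th]. *)
Lemma hip_le_top b x k : (0 < k <= n)%N -> lower_dir S b -> lower_dir S (e - b) ->
  htr S b = k%:R -> hip S b x <= \sum_(z <- take k (eig S x)) z.
Proof.
move=> /andP[k0 kn] hb hb' trb; have n0 := leq_trans k0 kn.
have [rho [hrho]] := residue_measure x n0 hb hb'; rewrite trb => Ek ->.
have kl : (0 < k <= size (eig S x))%N by rewrite k0 size_eig.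
have := sum_max_top (sorted_zeros_decr _) kl; set th := nth 0 _ _ => /= Etop.
suff : \sum_(r <- undup (eig S x)) rho r * (r - th) <= \sum_(z <- eig S x) Num.max (z - th) 0.
  have -> : \sum_(r <- undup (eig S x)) rho r * (r - th) =
      \sum_(r <- undup (eig S x)) rho r * r - th *+ k.
    rewrite -mulr_natl Ek mulr_suml -sumrB.
    by apply: eq_bigr => r _; rewrite mulrBr.
  rewrite Etop sumrB [X in _ <= _ - X]big_const_seq count_predT size_takel ?size_eig //.
  by rewrite iter_addr_0 lerD2r.
rewrite -[X in _ <= X]big_undup_iterop_count /=.
rewrite big_seq [X in _ <= X]big_seq; apply: ler_sum => r; rewrite mem_undup.
move=> /hrho /andP[r0 r1]; rewrite -/(GRing.natmul _ _) -mulr_natl.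
apply: le_trans (_ : rho r * Num.max (r - th) 0 <= _).
  by apply: ler_wpM2l => //; rewrite le_max lexx.
by apply: ler_wpM2r => //; rewrite le_max lexx orbT.
Qed.

Lemma doubly_stochastic_majorized (A : n.-tuple V) x :
  doubly_stochastic S A -> majorized (trmul S A x) (lam S x).
Proof.
move=> [hA trA sumA]; split=> [k /andP[k0 kn]|]; last first.
  rewrite !sum_rearr_decr_all; under eq_bigr do rewrite mxE.
  by rewrite -hip_suml sumA hipC hip_unit.
rewrite !sum_rearr_decr // decr_seq_lam /decr_seq sort_map -map_take big_map.
(* Indices ordered by decreasing [<a_i, x>]; the first [k] give the element [b] for [hip_le_top],
   and the others sum to [e - b]. *)
set t := sort _ _.
have pt : perm_eq t (enum 'I_n) by rewrite perm_sort.
have lowA i : lower_dir S (tnth A i) by apply: lower_dir_hcone.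
under eq_bigr do rewrite mxE; rewrite -hip_suml; apply: hip_le_top; rewrite ?k0 //.
- exact: lower_dir_sum.
- have -> : e = \sum_(i <- t) tnth A i by rewrite (perm_big _ pt) big_enum.
  rewrite -[in \sum_(i <- t) _](cat_take_drop k t) big_cat /= [X in X - _]addrC addrK.
  exact: lower_dir_sum.
- rewrite htr_sum; under eq_bigr do rewrite trA.
  rewrite big_const_seq count_predT size_takel ?iter_addr_0 //.
  by rewrite (perm_size pt) size_enum_ord.
Qed.

Lemma majorized_doubly_stochastic (A : n.-tuple V) :
  hcomplete S -> (forall a, hdual S a -> hcone S a) ->
  (forall x, majorized (trmul S A x) (lam S x)) -> doubly_stochastic S A.
Proof.
move=> cS dS hA.
have tr1 i : htr S (tnth A i) = 1.
  have lam1 j : lam S e j 0 = 1.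
    have : lam S e j 0 \in nseq n 1.
      by rewrite -(perm_mem (eig_unit S)) mxE mem_nth // size_eig.
    by move/nseqP => [].
  (* All eigenvalues of [e] are 1, so each entry is at least 1; their total [n] forces equality. *)
  have ge1 : forall j, 1 <= trmul S A e j 0.
    by apply: majorized_ge (hA e) _ => j; rewrite lam1.
  have := majorized_sum (hA e); under [RHS]eq_bigr do rewrite lam1.
  move=> /eqP; rewrite -subr_eq0 -sumrB psumr_eq0 => [|j _]; last by rewrite subr_ge0.
  by move=> /allP /(_ i (mem_index_enum _)) /=; rewrite mxE hip_unit subr_eq0 => /eqP.
split=> // [i|].
  apply: dS => y hy; have := majorized_ge (hA y) hy i; by rewrite mxE.
apply/eqP; rewrite -subr_eq0; apply/eqP; set u := _ - e.
(* Thus [u] lies in the radical of the form, in particular its eigenvalues have zero sum of squares,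
   and completeness gives [u = 0]. *)
have hu x : hip S u x = 0.
  rewrite hipDl hip_suml -scaleN1r -[_ *: e]addr0 hip_linearl hip0l addr0 mulN1r.
  rewrite [hip S e x]hipC hip_unit; have := majorized_sum (hA x).
  by under eq_bigr do rewrite mxE; move=> ->; rewrite subrr.
apply: cS; apply/matrixP => i j; rewrite ord1 [RHS]mxE.
have := hu u; rewrite hip_self enorm_lam -(sum_lam S u (fun l => l ^+ 2)) => /eqP.
rewrite psumr_eq0 => [/allP /(_ i (mem_index_enum _))|k _]; last exact: sqr_ge0.
by rewrite /= sqrf_eq0 => /eqP.
Qed.
End DoublyStochastic.

(** * Polynomial calculus in a Euclidean Jordan algebra *)

Section EuclideanJordan.
Variables (R : realType) (V : vectType R) (J : euclJordan V).
Local Notation mul := (jmul J).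
Local Notation ip := (jip J).
Local Notation one := (junit J).
Implicit Types (x y z u v w a b c : V) (f g : {poly R}).

Lemma jmulDr x y z : mul x (y + z) = mul x y + mul x z.
Proof. by have := jmul_linear J x 1 y z; rewrite !scale1r. Qed.

Lemma jmul0r x : mul x 0 = 0.
Proof. by apply: (addrI (mul x 0)); rewrite -jmulDr !addr0. Qed.

Lemma jmulZr (k : R) x y : mul x (k *: y) = k *: mul x y.
Proof. by rewrite -[k *: y]addr0 jmul_linear jmul0r addr0. Qed.

Lemma jmulNr x y : mul x (- y) = - mul x y.
Proof. by rewrite -scaleN1r jmulZr scaleN1r. Qed.

Lemma jmulDl x y z : mul (x + y) z = mul x z + mul y z.
Proof. by rewrite jmulC jmulDr !(jmulC J z). Qed.

Lemma jmulZl (k : R) x y : mul (k *: x) y = k *: mul x y.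
Proof. by rewrite jmulC jmulZr jmulC. Qed.

Lemma jmul_sumr (I : Type) (r : seq I) (P : pred I) (F : I -> V) x :
  mul x (\sum_(i <- r | P i) F i) = \sum_(i <- r | P i) mul x (F i).
Proof. exact: (big_morph (mul x) (jmulDr x) (jmul0r x)). Qed.

Lemma jipDr x y z : ip x (y + z) = ip x y + ip x z.
Proof. by have := jip_linear J x 1 y z; rewrite scale1r mul1r. Qed.

Lemma jip0r x : ip x 0 = 0.
Proof. by apply: (addrI (ip x 0)); rewrite -jipDr !addr0. Qed.

Lemma jipZr (k : R) x y : ip x (k *: y) = k * ip x y.
Proof. by rewrite -[k *: y]addr0 jip_linear jip0r addr0. Qed.

Lemma jipDl x y z : ip (x + y) z = ip x z + ip y z.
Proof. by rewrite jipC jipDr !(jipC J z). Qed.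

Lemma jipZl (k : R) x y : ip (k *: x) y = k * ip x y.
Proof. by rewrite jipC jipZr jipC. Qed.

Lemma jipNr x y : ip x (- y) = - ip x y.
Proof. by rewrite -scaleN1r jipZr mulN1r. Qed.

Lemma jipNl x y : ip (- x) y = - ip x y.
Proof. by rewrite -scaleN1r jipZl mulN1r. Qed.

Lemma jip_sumr (I : Type) (r : seq I) (P : pred I) (F : I -> V) x :
  ip x (\sum_(i <- r | P i) F i) = \sum_(i <- r | P i) ip x (F i).
Proof. exact: (big_morph (ip x) (jipDr x) (jip0r x)). Qed.

Lemma jip_ge0 x : 0 <= ip x x.
Proof. by have [->|/(jip_gt0 J)/ltW//] := eqVneq x 0; rewrite jip0r. Qed.

Lemma jip_eq0 x : ip x x = 0 -> x = 0.
Proof.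
by move=> E; apply/eqP; apply: contraT => /(jip_gt0 J); rewrite E ltxx.
Qed.

Lemma jip_inj u v : (forall t, ip u t = ip v t) -> u = v.
Proof.
move=> h; apply/eqP; rewrite -subr_eq0; apply/eqP/jip_eq0.
by rewrite jipDl jipNl h subrr.
Qed.

Lemma jip_sym a u v : ip (mul a u) v = ip u (mul a v).
Proof. exact: jip_assoc. Qed.

Lemma jip_sqr u : ip (mul u u) one = ip u u.
Proof. by rewrite jip_sym [mul u one]jmulC jmul_unit. Qed.

(** Inclusion-exclusion on the cubic form [t a a a] over the partial sums of [x], [y], [z]. *)
Lemma polarize3 (t : V -> V -> V -> R) :
  (forall a b c d, t (a + b) c d = t a c d + t b c d) ->
  (forall a b c d, t a (b + c) d = t a b d + t a c d) ->
  (forall a b c, t a b c = t a c b) -> (forall a, t a a a = 0) ->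
  forall x y z, t x y z + t y x z + t z x y = 0.
Proof.
move=> D1 D2 C23 diag x y z.
have D3 a b c d : t a b (c + d) = t a b c + t a b d by rewrite C23 D2 !(C23 a b).
have := diag (x + y + z); have := diag (x + y); have := diag (x + z).
have := diag (y + z); have := diag x; have := diag y; have := diag z.
rewrite !(D1, D2, D3) ?(C23 _ y x) ?(C23 _ z x) ?(C23 _ z y).
lra.
Qed.

(* The linearized Jordan identity, with [v] as the variable acted upon. *)
Lemma jordan_linearized a b v :
  mul v (mul a (mul a b)) = mul (mul a a) (mul b v) + 2 *: mul (mul a b) (mul a v)
     - mul a (mul a (mul b v)) - mul b (mul a (mul a v)).
Proof.
apply: jip_inj => s.
have P x y z w t' : ip (mul x (mul (mul y z) w) - mul (mul y z) (mul x w)) t' +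
    ip (mul y (mul (mul x z) w) - mul (mul x z) (mul y w)) t' +
    ip (mul z (mul (mul x y) w) - mul (mul x y) (mul z w)) t' = 0.
  apply: (polarize3 (t := fun x y z =>
    ip (mul x (mul (mul y z) w) - mul (mul y z) (mul x w)) t')).
  - move=> p q r s'; rewrite !jmulDl !jmulDr !(jipDl, jipNl); ring.
  - by move=> p q r s'; rewrite !jmulDl !jmulDr !(jipDl, jipNl); ring.
  - by move=> p q r; rewrite (jmulC J q).
  - by move=> p; rewrite jmul_jordan subrr -(scale0r 0) jipZl mul0r.
have := P a v b a s.
rewrite !(jipDl, jipNl, jipZl).
rewrite (jmulC J (mul v b) a) (jmulC J v b) (jmulC J v (mul (mul a b) a)).
rewrite (jmulC J (mul a b) a) (jmulC J v (mul a (mul a b))) (jmulC J v a).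
rewrite (jmulC J (mul a v) a) (jmulC J (mul b v) (mul a a)) (jmulC J b a).
rewrite (jmulC J (mul a v) (mul a b)).
lra.
Qed.

(** With [b = a^k], [jordan_linearized] writes multiplication by [a^(k+2)] through multiplications
    by [a], [a^2], [b] and [a b], all commuting with that by [a]; hence the induction on two
    consecutive powers. *)
Lemma jpow_comm a k v : mul a (mul (jpow J a k) v) = mul (jpow J a k) (mul a v).
Proof.
suff: (forall v, mul a (mul (jpow J a k) v) = mul (jpow J a k) (mul a v)) /\
      (forall v, mul a (mul (jpow J a k.+1) v) = mul (jpow J a k.+1) (mul a v)).
  by case.
elim: k => [|k [IH1 IH2]].
  split=> u; first by rewrite /= !jmul_unit.
  by rewrite /= [mul a one]jmulC jmul_unit.
split=> // u; rewrite ![jpow J a k.+2]/=.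
have E := jordan_linearized a (jpow J a k).
rewrite /= -/(jpow J a k) -/(iter k (mul a) one) in IH1 IH2 E *.
set b := jpow J a k in IH1 IH2 E *.
rewrite ![mul (mul a (mul a b)) _]jmulC !E.
have Ja w : mul a (mul (mul a a) w) = mul (mul a a) (mul a w) by apply: jmul_jordan.
rewrite !(jmulDr, jmulNr, jmulZr).
by rewrite Ja IH1 IH2 ![mul a (mul b _)]IH1.
Qed.

Definition jev x f : V := \sum_(i < size f) f`_i *: jpow J x i.

Lemma jevE x f m : (size f <= m)%N -> jev x f = \sum_(i < m) f`_i *: jpow J x i.
Proof.
move=> fm; rewrite /jev (big_ord_widen _ (fun i => f`_i *: jpow J x i) fm) big_mkcond.
by apply: eq_bigr => i _; case: ltnP => // h; rewrite nth_default // scale0r.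
Qed.

Lemma jevD x f g : jev x (f + g) = jev x f + jev x g.
Proof.
rewrite !(@jevE x _ (maxn (size f) (size g))) ?leq_maxl ?leq_maxr ?size_polyD //.
by rewrite -big_split; apply: eq_bigr => i _; rewrite coefD scalerDl.
Qed.

Lemma jevZ x (k : R) f : jev x (k *: f) = k *: jev x f.
Proof.
rewrite (@jevE x _ (size f)) ?size_scale_leq // scaler_sumr.
by apply: eq_bigr => i _; rewrite coefZ scalerA.
Qed.

Lemma jev0 x : jev x 0 = 0.
Proof. by rewrite /jev size_poly0 big_ord0. Qed.

Lemma jevN x f : jev x (- f) = - jev x f.
Proof. by rewrite -scaleN1r jevZ scaleN1r. Qed.

Lemma jevC x (k : R) : jev x k%:P = k *: one.
Proof.
by rewrite (@jevE x _ 1) ?size_polyC_leq1 // big_ord1 coefC.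
Qed.

Lemma jevMX x f : jev x (f * 'X) = mul x (jev x f).
Proof.
rewrite (@jevE x _ (size f).+1); last first.
  by apply: leq_trans (size_polyMleq _ _) _; rewrite size_polyX addn2.
rewrite big_ord_recl coefMX scale0r add0r jmul_sumr.
by apply: eq_bigr => i _; rewrite coefMX jmulZr.
Qed.

Lemma jevX x : jev x 'X = x.
Proof. by rewrite -['X]mul1r jevMX jevC scale1r jmulC jmul_unit. Qed.

Lemma jev_comm x f v : mul x (mul (jev x f) v) = mul (jev x f) (mul x v).
Proof.
rewrite ![mul (jev x f) _]jmulC !jmul_sumr; apply: eq_bigr => i _.
by rewrite !jmulZr ![mul _ (jpow J x i)]jmulC jpow_comm.
Qed.

Lemma jevM x f g : jev x (f * g) = mul (jev x f) (jev x g).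
Proof.
elim/poly_ind: f g => [|f k IH] g; first by rewrite mul0r jev0 jmulC jmul0r.
rewrite mulrDl jevD -mulrA [X in f * X]mulrC IH jevMX mul_polyC jevZ.
rewrite jevD jevMX jevC jmulDl jmulZl jmul_unit; congr (_ + _).
by rewrite -jev_comm [RHS]jmulC -jev_comm [mul (jev x f) _]jmulC.
Qed.

Lemma jev_free x m : free (mkseq (jpow J x) m) <->
  (forall f, (size f <= m)%N -> jev x f = 0 -> f = 0).
Proof.
set X := mkseq _ _; have sX : size X == m by rewrite size_mkseq.
have -> : free X = free (Tuple sX) by [].
split=> [/freeP h f sf E|h].
  apply/polyP => i; rewrite coef0; have [im|mi] := ltnP i m; last first.
    by rewrite nth_default // (leq_trans sf).
  apply: (h (fun i => f`_i) _ (Ordinal im)).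
  rewrite -[RHS]E (jevE x sf); apply: eq_bigr => j _ /=.
  by rewrite nth_mkseq.
apply/freeP => k E i.
have /polyP/(_ i) : \poly_(j < m) (if insub j is Some j' then k j' else 0) = 0.
  apply: h; first exact: size_poly.
  rewrite (jevE x (size_poly _ _)) -[RHS]E; apply: eq_bigr => j _.
  by rewrite coef_poly ltn_ord valK /= nth_mkseq.
by rewrite coef_poly ltn_ord valK coef0.
Qed.

(** Formal reality: [<u u, 1> = <u, u>], so a square vanishes only with its root. *)
Lemma jev_sqr_eq0 x f : jev x (f * f) = 0 -> jev x f = 0.
Proof.
by rewrite jevM => E; apply: jip_eq0; rewrite -jip_sqr E -(scale0r 0) jipZl mul0r.
Qed.

Lemma jev_sum_sqr_eq0 x f g : jev x (f * f + g * g) = 0 -> jev x f = 0 /\ jev x g = 0.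
Proof.
rewrite jevD !jevM => E.
have : ip (jev x f) (jev x f) + ip (jev x g) (jev x g) = 0.
  by rewrite -!jip_sqr -jipDl E -(scale0r 0) jipZl mul0r.
move=> /eqP; rewrite paddr_eq0 ?jip_ge0 // => /andP[/eqP Ef /eqP Eg].
by split; apply: jip_eq0.
Qed.

End EuclideanJordan.

(** * Idempotents, rank and Jordan frames *)

Section EuclideanJordanFrames.
Variables (R : realType) (V : vectType R) (J : euclJordan V).
Local Notation mul := (jmul J).
Local Notation ip := (jip J).
Local Notation one := (junit J).
Implicit Types (x y z u v w a b c : V) (f g : {poly R}).

(** The Peirce equation [2 L^3 - 3 L^2 + L = 0], from the linearized identity with both elements
    equal to [c]. *)
Lemma idempotent_cubic c u : jidempotent J c ->
  mul c u = 3 *: mul c (mul c u) - 2 *: mul c (mul c (mul c u)).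
Proof.
move=> cc; have := jordan_linearized J c c u; rewrite !cc [mul u c]jmulC => E; rewrite [LHS]E {E}.
apply: (jip_inj (J := J)) => t; rewrite !(jipDl, jipNl, jipZl); ring.
Qed.

(* On the spectrum {0, 1/2, 1} of multiplication by an idempotent one has       *)
(* X = X^2 + 4 (X - X^2)^2.                                                     *)
Lemma jip_idempotent c u : jidempotent J c -> ip u (mul c u) =
  ip (mul c u) (mul c u) +
  4 * ip (mul c u - mul c (mul c u)) (mul c u - mul c (mul c u)).
Proof.
move=> cc; have E1 := congr1 (ip u) (idempotent_cubic u cc).
have E2 := congr1 (fun v => ip u (mul c v)) (idempotent_cubic u cc).
rewrite /= in E2; move: E1 E2.
rewrite !(jmulDr, jmulNr, jmulZr) !(jipDr, jipNr, jipZr, jipDl, jipNl).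
rewrite !(jip_sym J c); lra.
Qed.

Lemma jip_idempotent_ge0 c u : jidempotent J c -> 0 <= ip u (mul c u).
Proof.
by move=> cc; rewrite (jip_idempotent u cc) addr_ge0 ?mulr_ge0 ?jip_ge0.
Qed.

Lemma jip_idempotent_eq0 c u : jidempotent J c -> ip u (mul c u) = 0 -> mul c u = 0.
Proof.
move=> cc; rewrite (jip_idempotent u cc) => /eqP.
by rewrite paddr_eq0 ?mulr_ge0 ?jip_ge0 // => /andP[/eqP/jip_eq0].
Qed.

Lemma jev_orthogonal_sum (m : nat) (d : 'I_m -> V) (l : 'I_m -> R) f :
  (forall i, mul (d i) (d i) = d i) -> (forall i j, i != j -> mul (d i) (d j) = 0) ->
  \sum_i d i = one -> jev J (\sum_i l i *: d i) f = \sum_i f.[l i] *: d i.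
Proof.
move=> idem orth sum1; elim/poly_ind: f => [|f k IH].
  by rewrite jev0 big1 // => i _; rewrite horner0 scale0r.
rewrite jevD jevMX jevC IH -sum1 scaler_sumr jmul_sumr -big_split /=.
apply: eq_bigr => i _; rewrite jmulZr jmulC jmul_sumr (bigD1 i) //= big1 => [|j ji].
  by rewrite jmulZr idem addr0 scalerA -scalerDl !hornerE.
by rewrite jmulZr orth 1?eq_sym // scaler0.
Qed.

(** The combination has the [m] distinct eigenvalues [0, ..., m - 1], so an annihilating polynomial
    of smaller degree has too many roots. *)
Lemma free_orthogonal (m : nat) (d : 'I_m -> V) :
  (forall i, mul (d i) (d i) = d i) -> (forall i, d i != 0) ->
  (forall i j, i != j -> mul (d i) (d j) = 0) -> \sum_i d i = one ->
  free (mkseq (jpow J (\sum_(i < m) i%:R *: d i)) m).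
Proof.
move=> idem nz orth sum1; apply/jev_free => f sf.
rewrite (jev_orthogonal_sum (fun i => i%:R)) // => E; apply/eqP.
apply: contraTT isT => nzf.
suff : (size [seq (nat_of_ord i)%:R : R | i <- enum 'I_m] < size f)%N.
  by rewrite size_map size_enum_ord ltnNge sf.
apply: max_poly_roots nzf _ _.
  apply/allP => _ /mapP[i _ ->]; apply/eqP.
  have := congr1 (mul (d i)) E; rewrite jmul0r jmul_sumr (bigD1 i) //= big1 => [|j ji].
    rewrite addr0 jmulZr idem => /eqP; rewrite scaler_eq0 (negbTE (nz i)) orbF.
    by move/eqP.
  by rewrite jmulZr orth 1?eq_sym // scaler0.
rewrite map_inj_uniq ?enum_uniq // => i j /eqP; rewrite eqr_nat => /eqP.
exact: val_inj.
Qed.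

Lemma jrank_not_free (n : nat) x : jrank J n -> ~~ free (mkseq (jpow J x) n.+1).
Proof.
move=> [_ rk]; apply/negP => fr.
have ex : exists m, ~~ free (mkseq (jpow J x) m).
  exists (\dim {:V}).+1; apply/negP => /eqP; rewrite size_mkseq => E.
  by have := dimvS (subvf <<mkseq (jpow J x) (\dim {:V}).+1>>%VS); rewrite E ltnn.
have [m nfm minm] := ex_minnP ex.
have m0 : (0 < m)%N by rewrite lt0n; apply: contraNneq nfm => ->; apply: nil_free.
have mn : (m <= n.+1)%N.
  rewrite -(prednK m0) ltnS; apply: (rk x); split; last by rewrite prednK.
  by apply: contraT => /minm; rewrite leqNgt prednK // leqnn.
case/negP: nfm; apply/jev_free => f sf.
by have /jev_free := fr; apply; apply: leq_trans mn.
Qed.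

(** Splitting one of the [n] idempotents would give [n + 1] orthogonal nonzero ones, beyond the rank
    by [free_orthogonal]. *)
Lemma orthogonal_idempotents_primitive (n : nat) (d : 'I_n -> V) j : jrank J n ->
  (forall i, mul (d i) (d i) = d i) -> (forall i, d i != 0) ->
  (forall i j, i != j -> mul (d i) (d j) = 0) -> \sum_i d i = one ->
  jprimitive J (d j).
Proof.
move=> rk idem nz orth sum1; split=> // -[a [b [aa bb nza nzb Eab]]].
have ab0 : mul a b = 0.
  have := idem j; rewrite Eab jmulDl !jmulDr aa bb (jmulC J b a).
  move=> E; apply: (jip_inj (J := J)) => t; have := congr1 (ip^~ t) E.
  by rewrite /= !jipDl [ip 0 t]jipC jip0r; lra.
(* [<d k, a>] and [<d k, b>] are nonnegative and sum to [<d k, d j> = 0], so both vanish, and with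
   them the products. *)
have orth_part k : k != j -> mul a (d k) = 0 /\ mul b (d k) = 0.
  move=> kj; have : ip (d k) (d j) = 0.
    by rewrite -{1}(idem k) jip_sym orth // jip0r.
  have part u : jidempotent J u -> ip (d k) u = ip u (mul (d k) u).
    by move=> uu; rewrite -{1}uu jipC jip_sym [mul u (d k)]jmulC.
  rewrite Eab jipDr (part a aa) (part b bb) => /eqP.
  rewrite paddr_eq0 ?jip_idempotent_ge0 // => /andP[/eqP Ea /eqP Eb].
  by rewrite ![mul _ (d k)]jmulC; split; apply: jip_idempotent_eq0.
pose d' (i : 'I_n.+1) := if unlift ord0 i is Some k then if k == j then a else d k else b.
case/negP: (jrank_not_free (\sum_(i < n.+1) i%:R *: d' i) rk).
apply: free_orthogonal => [i|i|i1 i2|]; rewrite /d'.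
- by case: unliftP => [k _|_]; [case: (k == j); [exact: aa | exact: idem] | exact: bb].
- by case: unliftP => [k _|_ //]; case: (k == j).
- case: unliftP => [k1 ->|->]; case: unliftP => [k2 ->|->] //.
  + rewrite (inj_eq lift_inj) => k12.
    have [E1|n1] := eqVneq k1 j; have [E2|n2] := eqVneq k2 j.
    * by rewrite E1 E2 eqxx in k12.
    * by case: (orth_part k2 n2).
    * by rewrite jmulC; case: (orth_part k1 n1).
    * exact: orth.
  + by have [//|n1 _] := eqVneq k1 j; rewrite jmulC; case: (orth_part k1 n1).
  + by have [E _|n2 _] := eqVneq k2 j; [rewrite jmulC|case: (orth_part k2 n2)].
rewrite big_ord_recl unlift_none -sum1 (bigD1 j) //= [RHS](bigD1 j) //= Eab.
rewrite liftK eqxx addrA [b + a]addrC; congr (_ + _).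
by apply: eq_bigr => k kj; rewrite liftK (negbTE kj).
Qed.

(** * Spectral theorem for a regular element *)

Section Regular.
Variables (n : nat) (z : V).
Hypothesis rk : jrank J n.
Hypothesis zreg : free (mkseq (jpow J z) n).

Let jev_inj f : (size f <= n)%N -> jev J z f = 0 -> f = 0.
Proof. by have /jev_free := zreg; apply. Qed.

Lemma min_poly_exists : exists2 M : {poly R}, size M = n.+1 & jev J z M = 0.
Proof.
apply: contrapT => H; case/negP: (jrank_not_free z rk); apply/jev_free => f sf E.
have [sf'|sf'] := leqP (size f) n; first exact: jev_inj.
by case: H; exists f => //; apply/eqP; rewrite eqn_leq sf.
Qed.

Lemma jev_dvdp (M f : {poly R}) : jev J z M = 0 -> M %| f -> jev J z f = 0.
Proof. by move=> EM /dvdpP[q ->]; rewrite jevM EM jmul0r. Qed.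

(** A nonreal root [a + i b] gives [M = K ((X - a)^2 + b^2)]. Then [K M] is the sum of the squares
    of [(X - a) K] and [b K], so [b K] annihilates [z] although its degree is below [n]. *)
Lemma min_poly_real (M : {poly R}) : size M = n.+1 -> jev J z M = 0 -> only_real_zeros M.
Proof.
move=> sM EM [a b]; rewrite complex_real => rM; apply: contraT => nzb.
have nzM : M != 0 by rewrite -size_poly_eq0 sM.
pose q : {poly R} := ('X - a%:P) ^+ 2 + (b ^+ 2)%:P.
have sq : size q = 3%N.
  rewrite /q size_polyDl size_exp_XsubC // (leq_ltn_trans (size_polyC_leq1 _)) //.
have nzq : q != 0 by rewrite -size_poly_eq0 sq.
have [K EMq0] : exists K, K = M %/ q by exists (M %/ q).
have EMq := divp_eq M q; rewrite -EMq0 in EMq; move: EMq0 => _.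
have sr : (size (M %% q)%R <= 2)%N by rewrite -ltnS -sq ltn_modp.
have r0 : M %% q = 0.
  have := rM; rewrite /root {1}EMq rmorphD rmorphM /= hornerD hornerM.
  have -> : (map_poly (real_complex R) q).[(a +i* b)%C] = 0.
    rewrite rmorphD rmorphXn rmorphB /= map_polyX !map_polyC /= !hornerE.
    by apply/eqP; rewrite eq_complex /=; apply/andP; split; apply/eqP; ring.
  rewrite mulr0 add0r (@horner_coef_wide _ 2); last by rewrite size_map_poly.
  rewrite !big_ord_recl big_ord0 !coef_map /= -[bump 0 0]/1%N expr0 expr1 eq_complex /=.
  rewrite !(mulr0, mul0r, addr0, add0r, subr0, mulr1) => /andP[/eqP E0 /eqP E1].
  have c1 : (M %% q)`_1 = 0 by apply: (mulIf nzb); rewrite mul0r.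
  have c0 : (M %% q)`_0 = 0 by move: E0; rewrite c1 mul0r addr0.
  apply/polyP => i; rewrite coef0; case: i => [|[|i]] //.
  by rewrite nth_default // (leq_trans sr).
rewrite r0 addr0 in EMq.
have nzK : K != 0 by apply: contraNneq nzM => K0; rewrite EMq K0 mul0r.
have sK : (size (b%:P * K)%R <= n)%N.
  have := sM; rewrite EMq size_mul // sq addn3 /= => -[<-].
  by rewrite mul_polyC (leq_trans (size_scale_leq _ _)).
have [_ E] : jev J z (('X - a%:P) * K) = 0 /\ jev J z (b%:P * K) = 0.
  apply: jev_sum_sqr_eq0; apply: jev_dvdp EM _; apply/dvdpP; exists K.
  rewrite [in RHS]EMq /q rmorphXn /=; clear; move: K ('X - a%:P) b%:P => k u v.
  by ring.
have /eqP := jev_inj sK E; rewrite mulf_eq0 polyC_eq0 (negbTE nzb) /=.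
by rewrite (negbTE nzK).
Qed.

(** The zeros of the annihilating polynomial [M] are simple: if [M = (X - r)^2 K], the square of
    [(X - r) K] is a multiple of [M], so [(X - r) K] already annihilates [z]. *)
Lemma regular_spectrum : exists s : seq R, [/\ uniq s, size s = n &
  forall f, all (root f) s -> jev J z f = 0].
Proof.
have [M sM EM] := min_poly_exists.
have nzM : M != 0 by rewrite -size_poly_eq0 sM.
have [s Es] := real_rooted_factor (min_poly_real sM EM).
have nzl : lead_coef M != 0 by rewrite lead_coef_eq0.
have us : uniq s.
  apply: count_mem_uniq => r; have [rs|rs] := boolP (r \in s); last exact/count_memPn.
  have r1 : (0 < count_mem r s)%N by rewrite -has_count has_pred1.
  apply/eqP; rewrite eqn_leq r1 andbT leqNgt; apply/negP => r2.
  pose K := lead_coef M *: (('X - r%:P) ^+ (count_mem r s - 2) *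
     \prod_(z <- s | z != r) ('X - z%:P)).
  have EK : M = ('X - r%:P) * (('X - r%:P) * K).
    rewrite [LHS]Es (prod_XsubC_split _ r) -{1}(subnK r2) exprD /K -!mul_polyC; ring.
  have nzX : 'X - r%:P != 0 :> {poly R} by rewrite polyXsubC_eq0.
  have nzXK : ('X - r%:P) * K != 0.
    by apply: contraNneq nzM => E; rewrite EK E mulr0.
  case/negP: (nzXK); apply/eqP; apply: jev_inj.
    by have := sM; rewrite EK size_mul // size_XsubC add2n /= => -[<-].
  apply: jev_sqr_eq0; apply: jev_dvdp EM _; apply/dvdpP; exists K.
  by rewrite [in RHS]EK; move: K ('X - r%:P) {EK nzXK nzX} => k u; ring.
exists s; split=> //.
  by have := sM; rewrite Es size_scale_prod_XsubC // => -[].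
move=> f fs; apply: jev_dvdp EM _; rewrite Es dvdpZl //.
by apply: uniq_roots_dvdp => //; rewrite uniq_rootsE.
Qed.

(** The frame consists of the Lagrange polynomials on the spectrum, evaluated at [z]. *)
Lemma regular_frame : exists (c : n.-tuple V) (l : 'cV[R]_n),
  jordan_frame J c /\ z = \sum_(i < n) l i 0 *: tnth c i.
Proof.
have [s [us ss hs]] := regular_spectrum.
pose Lag r : {poly R} := (\prod_(x <- rem r s) (r - x))^-1 *: \prod_(x <- rem r s) ('X - x%:P).
have LagE r q : r \in s -> q \in s -> (Lag r).[q] = (q == r)%:R.
  move=> rs qs; rewrite hornerZ horner_prod; have [->|qr] := eqVneq q r.
    rewrite [X in _ * X](eq_bigr (fun t => r - t)) => [|t _]; last by rewrite hornerXsubC.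
    rewrite mulVf // prodf_seq_neq0; apply/allP => x; rewrite mem_rem_uniq // inE /= subr_eq0.
    by case/andP=> xr _; rewrite eq_sym.
  apply/eqP; rewrite mulf_eq0 prodf_seq_eq0; apply/orP; right; apply/hasP; exists q.
    by rewrite mem_rem_uniq // inE qr.
  by rewrite /= hornerXsubC subrr.
pose l i := nth 0 s i.
have ls (i : 'I_n) : l i \in s by rewrite mem_nth // ss.
have l_inj (i j : 'I_n) : (l i == l j) = (i == j) by rewrite nth_uniq ?ss.
pose d (i : 'I_n) := jev J z (Lag (l i)).
have idem i : mul (d i) (d i) = d i.
  rewrite -jevM; apply/eqP; rewrite -subr_eq0 -jevN -jevD; apply/eqP/hs/allP => q qs.
  by rewrite /root hornerD hornerN hornerM !LagE //; case: (q == _); rewrite ?mulr1 ?mulr0 subrr.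
have nz i : d i != 0.
  apply/eqP => /jev_inj E; have := LagE (l i) (l i) (ls i) (ls i).
  rewrite E ?horner0 ?eqxx => [/eqP|]; first by rewrite eq_sym oner_eq0.
  rewrite (leq_trans (size_scale_leq _ _)) // size_prod_XsubC size_rem // ss.
  by rewrite prednK // -ss; case: (s) (ls i).
have orth i j : i != j -> mul (d i) (d j) = 0.
  move=> ij; rewrite -jevM; apply/hs/allP => q qs; rewrite /root hornerM !LagE //.
  have [->|_] := eqVneq q (l i); last by rewrite mul0r.
  by rewrite l_inj (negbTE ij) mulr0.
have jev_sum (f : {poly R}) : jev J z f = \sum_(i < n) f.[l i] *: d i.
  have -> : \sum_(i < n) f.[l i] *: d i = jev J z (\sum_(i < n) f.[l i] *: Lag (l i)).
    rewrite (big_morph (jev J z) (jevD J z) (jev0 J z)).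
    by apply: eq_bigr => i _; rewrite jevZ.
  apply/eqP; rewrite -subr_eq0 -jevN -jevD; apply/eqP/hs/allP => q qs.
  have /(nthP 0)[k] := qs; rewrite ss => kn Eq; pose i0 := Ordinal kn.
  have -> : q = l i0 by rewrite -Eq.
  rewrite /root hornerD hornerN horner_sum (bigD1 i0) // big1 => [|j ji].
    by rewrite hornerZ LagE // l_inj eqxx mulr1 /= addr0 subrr.
  by rewrite hornerZ LagE // l_inj eq_sym (negbTE ji) mulr0.
have sum1 : \sum_i d i = one.
  rewrite -[RHS]scale1r -(jevC J z) jev_sum; apply: eq_bigr => i _.
  by rewrite hornerC scale1r.
exists [tuple d i | i < n], (\col_i l i); split; last first.
  rewrite -[LHS](jevX J) jev_sum; apply: eq_bigr => i _.
  by rewrite hornerX mxE tnth_mktuple.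
split=> [i|i j ij|].
- by rewrite tnth_mktuple; apply: (orthogonal_idempotents_primitive i rk).
- by rewrite !tnth_mktuple orth.
- by rewrite -sum1; apply: eq_bigr => i _; rewrite tnth_mktuple.
Qed.

End Regular.

End EuclideanJordanFrames.

(** * Density of regular elements and limits along generic parameters *)

Section Density.
Variable R : realType.

(** [B] cannot vanish at all the points [N, N + 1, ...], so some admissible [s = 1 / (N + i)] is
    small enough for continuity of [G]. Genericity is in [s^-1] because
    [y + s x0 = s (x0 + s^-1 y)]. *)
Lemma horner0_ge0_generic (G B : {poly R}) (dl : R) : B != 0 -> 0 < dl ->
  (forall s, 0 < s < dl -> B.[s^-1] != 0 -> 0 <= G.[s]) -> 0 <= G.[0].
Proof.
move=> nzB dl0 h; rewrite leNgt; apply/negP => G0.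
have G0' : 0 < - G.[0] by rewrite oppr_gt0.
have [d d0 hd] := poly_cont 0 G G0'.
have [N HN] : exists N : nat, dl^-1 + d^-1 < N%:R.
  exists (Num.bound (dl^-1 + d^-1)); apply: archi_boundP.
  by rewrite addr_ge0 // invr_ge0 ltW.
pose rs : seq R := [seq (N + i)%:R | i <- iota 0 (size B)].
suff : (size rs < size B)%N by rewrite size_map size_iota ltnn.
apply: (max_poly_roots nzB).
  apply/allP => _ /mapP[i _ ->]; apply: contraT; rewrite /root => nzt.
  have tN : N%:R <= (N + i)%:R :> R by rewrite ler_nat leq_addr.
  have dl0' : 0 < dl^-1 by rewrite invr_gt0.
  have d0' : 0 < d^-1 by rewrite invr_gt0.
  have t0 : 0 < (N + i)%:R :> R by lra.
  set t := (N + i)%:R in nzt tN t0.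
  have tdl : t^-1 < dl by rewrite -[dl]invrK ltf_pV2 ?posrE //; lra.
  have td : t^-1 < d by rewrite -[d]invrK ltf_pV2 ?posrE //; lra.
  have s0 : 0 < t^-1 by rewrite invr_gt0.
  have := h t^-1; rewrite s0 tdl invrK => /(_ isT nzt) Gs.
  have := hd t^-1; rewrite subr0 gtr0_norm // => /(_ td) /ltr_normlW.
  by move: Gs; lra.
rewrite map_inj_uniq ?iota_uniq // => i j /eqP.
by rewrite eqr_nat eqn_add2l => /eqP.
Qed.

Lemma quadratic_ge0_generic (B : {poly R}) (a0 a1 a2 : R) : B != 0 ->
  (forall s, 0 < s -> B.[s^-1] != 0 -> 0 <= a0 + a1 * s + a2 * s ^+ 2) -> 0 <= a0.
Proof.
move=> nzB h; pose G : {poly R} := a0%:P + a1%:P * 'X + a2%:P * 'X ^+ 2.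
have EG s : G.[s] = a0 + a1 * s + a2 * s ^+ 2 by rewrite !hornerE.
have := horner0_ge0_generic (G := G) nzB ltr01; rewrite EG expr0n !mulr0 !addr0; apply.
by move=> s /andP[s0 _]; rewrite EG; apply: h.
Qed.

(** The coordinates of the powers of [x + t y] are polynomials in [t]. A right inverse [B0] of their
    matrix at [t = 0] makes [det (M t *m B0)] a polynomial with value 1 at 0, and the powers are
    free wherever it does not vanish. *)
Lemma free_jpow_generic (V : vectType R) (J : euclJordan V) (n : nat) (x y : V) :
  free (mkseq (jpow J x) n) -> exists2 B : {poly R}, B != 0 &
    forall t, B.[t] != 0 -> free (mkseq (jpow J (x + t *: y)) n).
Proof.
set d := \dim {:V}; pose cr j (v : V) := coord (vbasis {:V}) j v.
pose bs k := (vbasis {:V})`_k.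
have [w Ew] : exists w : nat -> 'I_d -> {poly R}, forall i j t,
    cr j (jpow J (x + t *: y) i) = (w i j).[t].
  pose stp (u : 'I_d -> {poly R}) (j : 'I_d) := \sum_(k < d)
    u k * ((cr j (jmul J x (bs k)))%:P + (cr j (jmul J y (bs k)))%:P * 'X).
  exists (fun i => iter i stp (fun j => (cr j (junit J))%:P)).
  elim=> [|i IH] j t /=; first by rewrite hornerC.
  rewrite -/(jpow J (x + t *: y) i) [in LHS](coord_vbasis (memvf (jpow J _ i))).
  rewrite jmul_sumr /cr linear_sum horner_sum; apply: eq_bigr => k _.
  rewrite jmulZr linearZ /= -/(cr k _) IH hornerM; congr (_ * _).
  by rewrite jmulDl jmulZl linearD linearZ /= !hornerE mulrC.
pose M (t : R) : 'M[R]_(n, d) := \matrix_(i, j) (w i j).[t].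
have jevM_row t (f : {poly R}) : (size f <= n)%N ->
    jev J (x + t *: y) f = 0 <-> (\row_(i < n) f`_i) *m M t = 0.
  move=> sf; have E j : cr j (jev J (x + t *: y) f) = ((\row_(i < n) f`_i) *m M t) 0 j.
    rewrite (jevE J _ sf) /cr linear_sum mxE; apply: eq_bigr => i _.
    by rewrite linearZ /= -/(cr j _) Ew !mxE.
  split=> [E0|E0].
    by apply/rowP => j; rewrite -E E0 /cr linear0 mxE.
  rewrite (coord_vbasis (memvf (jev J _ f))) big1 // => j _.
  by rewrite -/(cr j _) E E0 mxE scale0r.
move=> /jev_free frx.
have /row_freeP[B0 MB0] : row_free (M 0).
  apply: inj_row_free => v v0.
  have Ev : v = \row_(i < n) (rVpoly v)`_i by apply/rowP => i; rewrite mxE coef_rVpoly_ord.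
  have : rVpoly v = 0.
    apply: frx; first exact: size_poly.
    have := (jevM_row 0 (rVpoly v) (size_poly _ _)).2; rewrite scale0r addr0; apply.
    by rewrite -Ev.
  by move=> E; rewrite [LHS]Ev E; apply/rowP => i; rewrite !mxE coef0.
pose Mp : 'M[{poly R}]_(n, d) := \matrix_(i, j) w i j.
pose B := \det (Mp *m map_mx polyC B0).
have EB t : B.[t] = \det (M t *m B0).
  rewrite /B -[LHS]/(horner_eval t _) -det_map_mx map_mxM; congr (\det (_ *m _)).
    by apply/matrixP => i j; rewrite !mxE.
  by apply/matrixP => i j; rewrite !mxE /= /horner_eval hornerC.
exists B.
  apply: contra_eq_neq (EB 0) => ->.
  by rewrite horner0 MB0 det1 eq_sym oner_neq0.
move=> t nzt; apply/jev_free => f sf /(jevM_row t f sf) E.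
have uM : M t *m B0 \in unitmx by rewrite unitmxE -EB unitfE.
have /rowP E' : \row_(i < n) f`_i = 0.
  by rewrite -[LHS]mulmx1 -(mulmxV uM) !mulmxA E !mul0mx.
apply/polyP => i; rewrite coef0; have [im|mi] := ltnP i n.
  by have := E' (Ordinal im); rewrite !mxE.
by rewrite nth_default // (leq_trans sf).
Qed.

End Density.

(** * Completeness and self-duality of the determinant system *)

Section JordanSystem.
Variables (R : realType) (V : vectType R) (n : nat) (S : hypSystem V n).
Variable J : euclJordan V.
Hypotheses (rk : jrank J n) (unitE : hunit S = junit J).
Hypothesis det : is_jdet J n (peval (hpoly S)).
Local Notation p := (hpoly S).
Local Notation e := (hunit S).
Local Notation ip := (jip J).
Implicit Types (x y z a : V) (c : n.-tuple V) (l : 'cV[R]_n).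

Definition lin_comb c l : V := \sum_(i < n) l i 0 *: tnth c i.

Lemma lin_combD c l1 l2 : lin_comb c (l1 + l2) = lin_comb c l1 + lin_comb c l2.
Proof. by rewrite -big_split; apply: eq_bigr => i _; rewrite mxE scalerDl. Qed.

Lemma lin_combZ c (k : R) l : lin_comb c (k *: l) = k *: lin_comb c l.
Proof. by rewrite scaler_sumr; apply: eq_bigr => i _; rewrite mxE scalerA. Qed.

Lemma lin_comb_delta c k : lin_comb c (delta_mx k 0) = tnth c k.
Proof.
rewrite /lin_comb (bigD1 k) //= big1 => [|i ik]; last first.
  by rewrite mxE (negbTE ik) scale0r.
by rewrite mxE !eqxx scale1r addr0.
Qed.

Lemma lin_comb_unit c (t : R) : jordan_frame J c -> lin_comb c (const_mx t) = t *: e.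
Proof.
case=> _ _ sum1; rewrite unitE -sum1 scaler_sumr.
by apply: eq_bigr => i _; rewrite mxE.
Qed.

Lemma peval_frame c l : jordan_frame J c -> peval p (lin_comb c l) = \prod_i l i 0.
Proof. by move=> fc; apply: det; exists c. Qed.

Lemma perm_eig_frame c l : jordan_frame J c ->
  perm_eq (eig S (lin_comb c l)) [seq l i 0 | i <- enum 'I_n].
Proof.
move=> fc; apply: (@perm_eig _ _ _ S _ _ 1); first exact: oner_neq0.
apply: eq_poly_horner_neq0 => t _; rewrite horner_line_poly scale1r.
rewrite -(lin_comb_unit t fc) -scaleN1r -lin_combZ -lin_combD peval_frame //.
rewrite horner_prod big_map big_enum; apply: eq_bigr => i _.
by rewrite !mxE hornerXsubC mulN1r.
Qed.

Lemma enorm_frame c l : jordan_frame J c ->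
  enorm (lam S (lin_comb c l)) ^+ 2 = \sum_i l i 0 ^+ 2.
Proof. by move=> fc; rewrite enorm_lam (perm_big _ (perm_eig_frame l fc)) big_map big_enum. Qed.

Lemma hip_frame c l k : jordan_frame J c -> hip S (lin_comb c l) (tnth c k) = l k 0.
Proof.
move=> fc; rewrite -(lin_comb_delta c k) /hip -lin_combD -scaleN1r -lin_combZ -lin_combD.
transitivity (4^-1 * (\sum_i (l + delta_mx k 0) i 0 ^+ 2 -
    \sum_i (l + -1 *: delta_mx k 0) i 0 ^+ 2)).
  by congr (_ * (_ - _)); apply: enorm_frame.
rewrite -sumrB (bigD1 k) //= big1 => [|i ik].
  by rewrite !mxE !eqxx /=; field.
by rewrite !mxE (negbTE ik) /=; ring.
Qed.

Lemma hcone_frame c k : jordan_frame J c -> hcone S (tnth c k).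
Proof.
move=> fc; apply/hconeE; rewrite -(lin_comb_delta c k).
rewrite (perm_all _ (perm_eig_frame _ fc)) all_map; apply/allP => i _ /=.
by rewrite mxE ler0n.
Qed.

Lemma enorm_frame_elt c k : jordan_frame J c -> enorm (lam S (tnth c k)) ^+ 2 = 1.
Proof.
by move=> fc; rewrite -hip_self -{1}(lin_comb_delta c k) hip_frame // mxE !eqxx.
Qed.

(* For all but finitely many [s > 0] the element [y + s x0] is regular, so that    *)
(* its own spectral idempotents form a frame of full size [n]; statements about   *)
(* [y] then follow by letting [s] tend to 0, without compactness of the frames.   *)
Lemma generic_frame : exists x0, forall y, exists2 B : {poly R}, B != 0 &
  forall s, 0 < s -> B.[s^-1] != 0 ->
  exists c l, jordan_frame J c /\ y + s *: x0 = lin_comb c l.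
Proof.
have [[x0 [x0free _]] _] := rk; exists x0 => y.
have [B nzB hB] := free_jpow_generic y x0free; exists B => // s s0 /hB hs.
have [c [l [fc El]]] := regular_frame rk hs; exists c, (s *: l); split=> //.
by rewrite lin_combZ /lin_comb -El scalerDr scalerA divff ?gt_eqF // scale1r addrC.
Qed.

(** The constant does not depend on the frame, since [<c_i, c_i>] is at most [<1, 1>], the sum of
    all of them; this permits limits along varying frames. *)
Lemma jip_frame_le c l : jordan_frame J c ->
  ip (lin_comb c l) (lin_comb c l) <=
  ip (junit J) (junit J) * enorm (lam S (lin_comb c l)) ^+ 2.
Proof.
move=> fc; have [prim orth sum1] := fc.
have idem i : jmul J (tnth c i) (tnth c i) = tnth c i by case: (prim i).
have ipc i j : ip (tnth c i) (tnth c j) = (i == j)%:R * ip (tnth c i) (tnth c i).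
  have [->|ij] := eqVneq i j; first by rewrite mul1r.
  by rewrite mul0r -(idem i) jip_sym orth // jip0r.
have ipl i : ip (lin_comb c l) (tnth c i) = l i 0 * ip (tnth c i) (tnth c i).
  rewrite jipC jip_sumr (bigD1 i) //= big1 => [|j ji]; first by rewrite jipZr addr0.
  by rewrite jipZr ipc eq_sym (negbTE ji) mul0r mulr0.
have ipe : ip (junit J) (junit J) = \sum_i ip (tnth c i) (tnth c i).
  rewrite -{1}sum1 jipC jip_sumr; apply: eq_bigr => i _.
  by rewrite jipC -jip_sqr idem.
rewrite enorm_frame // {2}/lin_comb jip_sumr mulr_sumr.
apply: ler_sum => i _; rewrite jipZr ipl mulrA -expr2 mulrC ler_wpM2r ?sqr_ge0 //.
by rewrite ipe (bigD1 i) //= lerDl sumr_ge0 // => j _; apply: jip_ge0.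
Qed.

Lemma hip_quadratic y x0 (s : R) : enorm (lam S (y + s *: x0)) ^+ 2 =
  enorm (lam S y) ^+ 2 + 2 * hip S y x0 * s + enorm (lam S x0) ^+ 2 * s ^+ 2.
Proof.
have expand (q qy q0 hy h0 hy0 h0y : R) : q = qy + s * q0 -> qy = hy + s * h0y ->
    q0 = hy0 + s * h0 -> h0y = hy0 -> q = hy + 2 * hy0 * s + h0 * s ^+ 2.
  by move=> -> -> -> ->; ring.
have E w : hip S (y + s *: x0) w = hip S y w + s * hip S x0 w.
  by rewrite addrC hip_linearl addrC.
apply: expand (hipC S x0 y).
- exact: etrans (esym (hip_self S _)) (E _).
- by apply: etrans (hipC S _ _) (etrans (E _) _); congr (_ + _); apply: hip_self.
- by apply: etrans (hipC S _ _) (etrans (E _) _); congr (_ + _ * _); apply: hip_self.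
Qed.

(** Both sides of [jip_frame_le] at [y + s x0] are quadratic in [s]; letting [s] tend to 0 gives
    [<y, y> <= 0] in the algebra's inner product. *)
Lemma jordan_complete : hcomplete S.
Proof.
move=> y ly0; have Ny : enorm (lam S y) ^+ 2 = 0.
  by rewrite enorm_lam -(sum_lam S y (fun q : R => q ^+ 2)) ly0 big1 // => i _; rewrite mxE expr0n.
have [x0 /(_ y)[B nzB hB]] := generic_frame.
have ipy : 0 <= ip (junit J) (junit J) * enorm (lam S y) ^+ 2 - ip y y.
  apply: (quadratic_ge0_generic
    (a1 := ip (junit J) (junit J) * (2 * hip S y x0) - 2 * ip y x0)
    (a2 := ip (junit J) (junit J) * enorm (lam S x0) ^+ 2 - ip x0 x0) nzB) => s s0 nzs.
  have [c [l [fc El]]] := hB s s0 nzs; have := jip_frame_le l fc; rewrite -El.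
  have expand (q k ny h nx iz iyy iyx ixx : R) : iz <= k * q ->
      q = ny + 2 * h * s + nx * s ^+ 2 -> iz = iyy + 2 * iyx * s + ixx * s ^+ 2 ->
      0 <= (k * ny - iyy) + (k * (2 * h) - 2 * iyx) * s + (k * nx - ixx) * s ^+ 2.
    by move=> + Eq Ei; rewrite Eq Ei -subr_ge0 => /le_trans; apply; lra.
  move=> hle; apply: expand hle (hip_quadratic y x0 s) _.
  rewrite jipDl !jipDr !jipZl !jipZr (jipC J x0 y).
  by move: (ip y y) (ip y x0) (ip x0 x0) => *; ring.
move: ipy; rewrite Ny mulr0 add0r oppr_ge0 => iyy.
by apply: (jip_eq0 (J := J)); apply/eqP; rewrite eq_le iyy jip_ge0.
Qed.

Lemma jordan_dual a : hdual S a -> hcone S a.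
Proof.
have half (u v w : R) : u * (2 * v) < w -> u * v < w / 2 by lra.
move=> da; apply/hconeE/allP => t ta; rewrite leNgt; apply/negP => t0.
have [x0 /(_ a)[B nzB hB]] := generic_frame.
(* [- m] bounds [<x0, c_k>] below in every frame: expand the squared norm of [x0 + c_k], where [c_k]
   has norm 1. *)
pose m := (enorm (lam S x0) ^+ 2 + 1) / 2.
have m0 : 0 < m by rewrite divr_gt0 // ltr_wpDl ?sqr_ge0.
have m2 : 0 < 2 * m by apply: mulr_gt0.
have dl0 : 0 < - t / (2 * m) by apply: divr_gt0; rewrite ?oppr_gt0.
(* [G(s) = p(a - t e + s x0) - (- t / 2)^n]. For small generic [s] the frame coordinates of
   [a + s x0] are at least [t / 2], so [G(s) >= 0]; but [p(a - t e) = 0] makes [G(0)] negative. *)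
pose G : {poly R} := pencil p (a - t *: e) (- x0) - ((- t / 2) ^+ n)%:P.
have : 0 <= G.[0].
  apply: (horner0_ge0_generic nzB dl0) => s /andP[s0 sdl] nzs.
  have [c [l [fc El]]] := hB s s0 nzs.
  have lge k : - t / 2 <= l k 0 - t.
    have := hip_frame l k fc; rewrite -El addrC hip_linearl => <-.
    have hac : 0 <= hip S a (tnth c k) by apply: da; apply: hcone_frame.
    have hxc : - m <= hip S x0 (tnth c k).
      have expand (q nx h nc : R) : 0 <= q -> q = nx + 2 * h * 1 + nc * 1 ^+ 2 ->
        nc = 1 -> - ((nx + 1) / 2) <= h by move=> + + E; rewrite E => + Eq; rewrite Eq; lra.
      exact: expand (sqr_ge0 _) (hip_quadratic x0 (tnth c k) 1) (enorm_frame_elt k fc).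
    have hs : s * m < - t / 2.
      by apply: half; rewrite -ltr_pdivlMr.
    have : s * - m <= s * hip S x0 (tnth c k) by rewrite ler_pM2l.
    by move: (hip S x0 _) (hip S a _) hac => u v *; lra.
  rewrite /G hornerD hornerN hornerC horner_pencil scalerN opprK subr_ge0.
  have -> : a - t *: e + s *: x0 = lin_comb c (l - const_mx t).
    by rewrite -[- const_mx t]scaleN1r lin_combD lin_combZ lin_comb_unit // scaleN1r -El addrAC.
  rewrite peval_frame // -[X in _ ^+ X]card_ord -prodr_const.
  apply: ler_prod => k _; rewrite !mxE lge andbT divr_ge0 // oppr_ge0 ltW //.
rewrite /G hornerD hornerN hornerC horner_pencil scale0r subr0 subr_ge0.
have : root (line_poly p e a) t.
  by rewrite line_polyE rootZ ?hpoly_unit_neq0 // root_prod_XsubC.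
rewrite /root horner_line_poly -opprB -scaleN1r (peval_scale _ _ (hpoly_homog S)).
rewrite mulf_eq0 expf_eq0 oppr_eq0 oner_eq0 andbF /= => /eqP ->.
by rewrite leNgt exprn_gt0 // divr_gt0 // oppr_gt0.
Qed.

End JordanSystem.

Theorem theorem5p3 (R : realType) (V : vectType R) (n : nat)
    (S : hypSystem V n) (A : n.-tuple V) :
  (doubly_stochastic S A ->
     forall x : V, majorized (trmul S A x) (lam S x)) /\
  (hcomplete S -> hcone S = hdual S ->
     (forall x : V, majorized (trmul S A x) (lam S x)) ->
     doubly_stochastic S A) /\
  (forall J : euclJordan V,
     jrank J n -> hunit S = junit J -> is_jdet J n (peval (hpoly S)) ->
     (forall x : V, majorized (trmul S A x) (lam S x)) ->
     doubly_stochastic S A).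
Proof.
split; [|split].
- by move=> dA x; apply: doubly_stochastic_majorized.
- by move=> cS dS; apply: majorized_doubly_stochastic => // a; rewrite dS.
- move=> J rk unitE det; apply: majorized_doubly_stochastic.
    exact: jordan_complete rk unitE det.
  by move=> a da; apply: (jordan_dual rk unitE det da).
Qed.
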